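(* Let $(P_n)_{n\ge 1}$ be a sequence of irreducible stochastic matrices, $P_n$ acting on a finite state space $\mathscr{X}_n$ with $|\mathscr{X}_n|\ge 3$, each with symmetric support and non-negative curvature (in the Ollivier-Ricci sense or in the Bakry-Émery sense, indifferently). Write $\mathrm{t}_{\mathrm{mix}}^{(n)}(\cdot)$, $\mathrm{t}_{\mathrm{rel}}^{(n)}$, $\Delta_n$ for the mixing times, relaxation time and sparsity parameter of $P_n$. Suppose that for every fixed $\varepsilon\in(0,1)$, $$\frac{\left(\mathrm{t}_{\mathrm{rel}}^{(n)}\log\Delta_n\right)^2}{\mathrm{t}_{\mathrm{mix}}^{(n)}(\varepsilon)}\xrightarrow[n\to\infty]{}0.$$ Then the sequence exhibits cutoff, i.e. for every fixed $\varepsilon\in(0,1)$, $\mathrm{t}_{\mathrm{mix}}^{(n)}(1-\varepsilon)/\mathrm{t}_{\mathrm{mix}}^{(n)}(\varepsilon)\to 1$ as $n\to\infty$. More precisely, for every $\varepsilon\in(0,\frac12)$, $$\mathrm{t}_{\mathrm{mix}}^{(n)}(\varepsilon)-\mathrm{t}_{\mathrm{mix}}^{(n)}(1-\varepsilon)\ \lesssim\ \sqrt{\mathrm{t}_{\mathrm{mix}}^{(n)}(1/4)}\;\mathrm{t}_{\mathrm{rel}}^{(n)}\log\Delta_n ,$$ where $a_n\lesssim b_n$ means that the ratio $a_n/b_n$ is bounded above uniformly in $n$ (the bound may depend on $\varepsilon$).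
   Context: Let $P$ be an irreducible stochastic matrix on a finite set $\mathscr{X}$, with unique invariant law $\pi=\pi P$. Heat kernel: $\mathscr{P}_t(x,y)=e^{-t}\sum_{k\ge 0}\frac{P^k(x,y)t^k}{k!}$ for $t\ge0$, acting on functions by $(\mathscr{P}_tf)(x)=\sum_y\mathscr{P}_t(x,y)f(y)$. Mixing time: $\mathrm{t}_{\mathrm{mix}}(\varepsilon)=\min\{t\ge 0:\max_{x}\|\mathscr{P}_t(x,\cdot)-\pi\|_{\mathrm{TV}}\le\varepsilon\}$, $\varepsilon\in(0,1)$, with $\|\mu-\pi\|_{\mathrm{TV}}=\max_{A\subseteq\mathscr{X}}|\mu(A)-\pi(A)|$. Generator: $(\mathscr{L}f)(x)=\sum_yP(x,y)(f(y)-f(x))$. Carré du champ: $\Gamma(f,g)(x)=\frac12\sum_yP(x,y)(f(y)-f(x))(g(y)-g(x))$. Relaxation time: $\mathrm{t}_{\mathrm{rel}}$ is the optimal constant in $\mathrm{Var}_\pi(f)\le \mathrm{t}_{\mathrm{rel}}\,\mathbf{E}_\pi[\Gamma(f,f)]$ for all $f:\mathscr{X}\to\mathbb{R}$ (equivalently the inverse spectral gap of $\frac{P+P^\star}{2}$, with $P^\star(x,y)=\pi(y)P(y,x)/\pi(x)$). $P$ is not assumed reversible. Symmetric support: $P(x,y)>0\iff P(y,x)>0$. In that case $\mathrm{dist}(x,y)=\min\{k\in\mathbb{Z}_+:P^k(x,y)>0\}$ is a metric on $\mathscr{X}$, and $x\sim y$ means $\mathrm{dist}(x,y)=1$. Sparsity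 parameter: $\Delta=\max\{1/P(x,y): x\sim y\}$. Ollivier-Ricci curvature: the largest $\kappa$ such that $\mathcal{W}_1(\mathscr{P}_t(x,\cdot),\mathscr{P}_t(y,\cdot))\le e^{-\kappa t}\,\mathrm{dist}(x,y)$ for all $t\ge0$ and $x,y\in\mathscr{X}$, where $\mathcal{W}_1$ is the $L^1$-Wasserstein distance associated with $\mathrm{dist}$. Bakry-Émery curvature: the largest $\kappa$ such that $\frac12\mathscr{L}\Gamma(f,f)\ge\Gamma(f,\mathscr{L}f)+\kappa\Gamma(f,f)$ pointwise for all $f:\mathscr{X}\to\mathbb{R}$. Non-negative curvature means that at least one of these two curvatures is $\ge0$. *)

(* Defs.v *)
From HB Require Import structures.
From mathcomp Require Import all_boot all_order all_algebra.
From mathcomp Require Import all_classical all_reals all_analysis.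

Set Implicit Arguments.
Unset Strict Implicit.
Unset Printing Implicit Defensive.

Import Order.TTheory GRing.Theory Num.Theory.
Import numFieldNormedType.Exports.

Local Open Scope classical_set_scope.
Local Open Scope ring_scope.

Section Chain.
Context {R : realType} {X : finType}.
Implicit Types (P : X -> X -> R) (mu nu pi f g : X -> R) (x y : X) (t eps : R).

Definition stochastic P : Prop :=
  (forall x y, 0 <= P x y) /\ (forall x, \sum_y P x y = 1).

Fixpoint kpow P (k : nat) x y : R :=
  if k is k'.+1 then \sum_z P x z * kpow P k' z y else (x == y)%:R.

Definition irreducible P : Prop := forall x y, exists k, 0 < kpow P k x y.

Definition symmetric_support P : Prop := forall x y, 0 < P x y <-> 0 < P y x.

Definition law mu : Prop := (forall x, 0 <= mu x) /\ \sum_x mu x = 1.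

Definition invariant_law P pi : Prop :=
  law pi /\ forall y, \sum_x pi x * P x y = pi y.

Definition heat P t x y : R :=
  expR (- t) * limn (series (fun k => kpow P k x y * t ^+ k / k`!%:R)).

Definition dTV mu nu : R :=
  \big[Num.max/0]_(A : {set X}) `|\sum_(x in A) mu x - \sum_(x in A) nu x|.

(* For an irreducible chain the set below is nonempty and closed, so that its
   infimum is a minimum. *)
Definition tmix P pi eps : R :=
  inf [set t | 0 <= t /\ \big[Num.max/0]_x dTV (heat P t x) pi <= eps].

Definition generator P f x : R := \sum_y P x y * (f y - f x).

Definition Gamma P f g x : R :=
  2^-1 * \sum_y P x y * (f y - f x) * (g y - g x).

Definition mean pi f : R := \sum_x pi x * f x.

Definition var pi f : R := mean pi (fun x => (f x - mean pi f) ^+ 2).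

(* The infimum is attained when P is irreducible and X has at least two
   points. *)
Definition trel P pi : R :=
  inf [set c | forall f, var pi f <= c * mean pi (Gamma P f f)].

(* The value 0 for unreachable pairs is irrelevant when P is irreducible. *)
Definition dist P x y : nat :=
  match pselect (exists k, 0 < kpow P k x y) with
  | left xy => ex_minn xy
  | right _ => 0%N
  end.

Definition adjacent P x y : bool := dist P x y == 1%N.

Definition sparsity P : R :=
  \big[Num.max/0]_(e : X * X | adjacent P e.1 e.2) (P e.1 e.2)^-1.

Definition coupling mu nu (q : X -> X -> R) : Prop :=
  [/\ forall x y, 0 <= q x y,
      forall x, \sum_y q x y = mu x
    & forall y, \sum_x q x y = nu y].

Definition W1 P mu nu : R :=
  inf [set \sum_x \sum_y q x y * (dist P x y)%:R | q in coupling mu nu].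

(* Both curvatures are the largest element of a closed, downward closed set of
   reals.  The supremum is taken in \bar R, so that an empty set would
   have curvature -oo rather than a default real value. *)
Definition ollivier_ricci P : \bar R :=
  ereal_sup [set kappa%:E | kappa in [set kappa : R |
    forall t x y, 0 <= t ->
      W1 P (heat P t x) (heat P t y) <= expR (- kappa * t) * (dist P x y)%:R]].

Definition bakry_emery P : \bar R :=
  ereal_sup [set kappa%:E | kappa in [set kappa : R |
    forall f x,
      Gamma P f (generator P f) x + kappa * Gamma P f f x <=
      2^-1 * generator P (Gamma P f f) x]].

Definition nonneg_curved P : Prop :=
  (0 <= ollivier_ricci P)%E \/ (0 <= bakry_emery P)%E.

End Chain.

(* The multiplicative form avoids dividing by a possibly zero b n. *)
Definition lesssim {R : realType} (a b : nat -> R) : Prop :=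
  exists C : R, forall n, a n <= C * b n.

(* Main.v *)
Require Import Defs.
From HB Require Import structures.
From mathcomp Require Import all_boot all_order all_algebra.
From mathcomp Require Import all_classical all_reals all_analysis.
From mathcomp Require Import ring lra zify.

Set Implicit Arguments.
Unset Strict Implicit.
Unset Printing Implicit Defensive.

Import Order.TTheory GRing.Theory Num.Theory.
Import numFieldNormedType.Exports.

Local Open Scope classical_set_scope.
Local Open Scope ring_scope.

(** Fix a starting point [o], write [t] for a time at which the total variation
distance is at most [1 - eps], and let [g = log (P_t(o,.) / pi)].

The distance to [o] grows at speed at most one, while the Poincare inequality
concentrates it under [pi]; as [P_t(o,.)] and [pi] overlap, the diameter is
[O(t + sqrt (t_rel / eps))], hence [O(t)] under the product condition.  Once
[t] is comparable to the diameter, the number of jumps given the position has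
an exponential moment controlled by [t log Delta], and this makes [g] Lipschitz
with constant [L = O(log Delta)].  Non-negative curvature of either kind turns
this into the varentropy bound [Var (g) <= L^2 t] under [P_t(o,.)].

By Chebyshev, [g] stays within [r = O(L sqrt t)] of its mean, and the overlap
with [pi] bounds that mean by [r + log (2/eps)].  So up to mass [eps/2] the law
[P_t(o,.)] has density at most [exp (2 r + log (2/eps))], and L2 contraction
mixes it after a further time [t_rel (r + O(log (1/eps)))], which is of order
[t_rel log Delta sqrt t].

Pitfall: a vanishing mixing time makes the ratio of the product condition [0],
so that [t_mix(eps) > 0] for large [n] has to be extracted from the condition
at [eps = 1/4], where it always holds. *)

(** * Calculus in one real variable *)

Section Calculus.
Context {R : realType}.

(** Differentiability is asked for on the whole line, which avoids one-sided derivatives at the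
    ends; the heat kernel, an entire series times [expR (- t)], always has it. *)
Lemma increment_le (f df : R -> R) (c t : R) :
  0 <= t -> (forall s : R, is_derive s 1 f (df s)) ->
  (forall s, 0 <= s <= t -> df s <= c) -> f t - f 0 <= c * t.
Proof.
move=> t0 Df dfc.
have [r rin ->] : exists2 r, r \in `[0, t] & f t - f 0 = df r * (t - 0).
  apply: MVT_segment => //; apply: derivable_within_continuous => x _.
  by have [] := Df x.
by rewrite subr0 ler_wpM2r// dfc//; move: rin; rewrite in_itv.
Qed.

Lemma derive0_constant (f : R -> R) (t : R) :
  0 <= t -> (forall s : R, is_derive s 1 f 0) -> f t = f 0.
Proof.
move=> t0 Df.
have DN (s : R) : is_derive s 1 (- f) 0.
  by have := is_deriveN (Df s); rewrite oppr0.
have := increment_le t0 Df (fun s _ => lexx 0).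
have := increment_le t0 DN (fun s _ => lexx 0).
by rewrite mul0r !fctE; lra.
Qed.

Lemma is_derive_finsum (X : finType) (F : X -> R -> R) (dF : X -> R) (s : R) :
  (forall z, is_derive s 1 (F z) (dF z)) ->
  is_derive s 1 (fun r => \sum_z F z r) (\sum_z dF z).
Proof.
move=> DF.
have -> : (fun r => \sum_z F z r) = \sum_z F z.
  by apply/funext => r; rewrite fct_sumE.
by elim/big_ind2 : _ => // [|*]; [exact: is_derive_cst|exact: is_deriveD].
Qed.

Lemma is_derive_mul (f g : R -> R) (s df dg : R) :
  is_derive s 1 f df -> is_derive s 1 g dg ->
  is_derive s 1 (fun r => f r * g r) (f s * dg + df * g s).
Proof.
by move=> Df Dg; have := is_deriveM Df Dg; rewrite /GRing.scale/= (mulrC (g s)).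
Qed.

Lemma is_derive_cmul (c : R) (f : R -> R) (s df : R) :
  is_derive s 1 f df -> is_derive s 1 (fun r => c * f r) (c * df).
Proof.
by move=> Df; have := is_derive_mul (is_derive_cst c s 1) Df; rewrite mul0r addr0.
Qed.

Lemma is_derive_sqr (f : R -> R) (s df : R) :
  is_derive s 1 f df -> is_derive s 1 (fun r => f r ^+ 2) (2 * f s * df).
Proof.
move=> Df; have := is_derive_mul Df Df; set d := _ + _.
by have -> : d = 2 * f s * df by rewrite /d; ring.
Qed.

Lemma is_derive_reverse (f df : R -> R) (t s : R) :
  (forall r : R, is_derive r 1 f (df r)) ->
  is_derive s 1 (fun r => f (t - r)) (- df (t - s)).
Proof.
move=> Df.
have D1 : is_derive s 1 (fun r : R => t - r) (- 1).
  have := is_deriveB (is_derive_cst t s (1:R)) (is_derive_id s (1:R)).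
  by rewrite sub0r.
have := is_derive1_comp (f := f) (g := fun r => t - r) (Df (t - s)) D1.
by rewrite mulrN1.
Qed.

Lemma cvg_finsum (X : finType) (u : X -> nat -> R) (l : X -> R) :
  (forall z, u z n @[n --> \oo] --> l z) ->
  (\sum_z u z n) @[n --> \oo] --> \sum_z l z.
Proof.
move=> ul; have -> : (fun n => \sum_z u z n) = \sum_z u z.
  by apply/funext => r; rewrite fct_sumE.
by elim/big_ind2 : _ => // [|*]; [exact: cvg_cst|exact: cvgD].
Qed.

End Calculus.

(** * The heat semigroup *)

Section Heat.
Context {R : realType} {X : finType}.
Variable P : X -> X -> R.
Hypothesis P_stoch : stochastic P.

Lemma kpow_ge0 k x y : 0 <= kpow P k x y.
Proof.
elim: k x y => [|k IH] x y /=; first by rewrite ler0n.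
by apply: sumr_ge0 => z _; rewrite mulr_ge0 // P_stoch.1.
Qed.

Lemma kpow_sum1 k x : \sum_y kpow P k x y = 1.
Proof.
elim: k x => [|k IH] x /=.
  by rewrite (bigD1 x)//= eqxx big1 ?addr0// => i /negPf; rewrite eq_sym => ->.
rewrite exchange_big/= -[RHS](P_stoch.2 x); apply: eq_bigr => z _.
by rewrite -mulr_sumr IH mulr1.
Qed.

Lemma kpow_le1 k x y : kpow P k x y <= 1.
Proof.
rewrite -(kpow_sum1 k x) (bigD1 y)//= lerDl.
by apply: sumr_ge0 => z _; exact: kpow_ge0.
Qed.

Lemma kpowSr k x y : kpow P k.+1 x y = \sum_z kpow P k x z * P z y.
Proof.
elim: k x y => [|k IH] x y.
  rewrite /= (bigD1 y)//= eqxx mulr1 big1 ?addr0; last first.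
    by move=> i /negPf ->; rewrite mulr0.
  rewrite (bigD1 x)//= eqxx mul1r big1 ?addr0// => i /negPf.
  by rewrite eq_sym => ->; rewrite mul0r.
rewrite -[LHS]/(\sum_z P x z * kpow P k.+1 z y).
under eq_bigr do rewrite IH mulr_sumr.
rewrite exchange_big/=; apply: eq_bigr => w _.
by rewrite mulr_suml; apply: eq_bigr => z _; rewrite mulrA.
Qed.

Lemma kpowD k l x y : kpow P (k + l) x y = \sum_z kpow P k x z * kpow P l z y.
Proof.
elim: k x => [|k IH] x.
  rewrite /= (bigD1 x)//= eqxx mul1r big1 ?addr0// => i /negPf.
  by rewrite eq_sym => ->; rewrite mul0r.
rewrite addSn /=.
under eq_bigr do rewrite IH mulr_sumr.
rewrite exchange_big/=; apply: eq_bigr => w _.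
by rewrite mulr_suml; apply: eq_bigr => z _; rewrite mulrA.
Qed.

Lemma kpowS_gt0 k x y : 0 < kpow P k.+1 x y ->
  exists z, 0 < P x z /\ 0 < kpow P k z y.
Proof.
rewrite /= => xy.
have [[z xz]|no] := pselect (exists z, 0 < P x z * kpow P k z y); last first.
  move: xy; rewrite big1 ?ltxx// => z _; apply/eqP; rewrite eq_le mulr_ge0 ?andbT.
  - by rewrite leNgt; apply/negP => ?; apply: no; exists z.
  - exact: P_stoch.1.
  - exact: kpow_ge0.
have Pxz : 0 < P x z.
  rewrite lt_neqAle P_stoch.1 andbT; apply/eqP => /esym p0.
  by move: xz; rewrite p0 mul0r ltxx.
by exists z; split=> //; move: xz; rewrite pmulr_rgt0.
Qed.

(** * The heat kernel as a power series *)

Definition kcoeff x y (k : nat) : R := kpow P k x y / k`!%:R.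

Definition kexp x y (t : R) : R := limn (pseries (kcoeff x y) t).

Lemma heatE t x y : heat P t x y = expR (- t) * kexp x y t.
Proof.
rewrite /heat /kexp /pseries; congr (_ * _).
suff -> : (fun k => kpow P k x y * t ^+ k / k`!%:R) =
  (fun k => kcoeff x y k * t ^+ k) by [].
by apply/funext => k; rewrite /kcoeff mulrAC.
Qed.

Lemma is_cvg_kexp_ge0 x y (t : R) : 0 <= t -> cvgn (pseries (kcoeff x y) t).
Proof.
move=> t0; apply: (@series_le_cvg _ _ (exp_coeff t)).
- move=> n; rewrite mulr_ge0 ?exprn_ge0// divr_ge0 ?ler0n//; exact: kpow_ge0.
- by move=> n; exact: exp_coeff_ge0.
- move=> n; rewrite exp_coeffE/= ler_wpM2r ?exprn_ge0// /kcoeff.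
  by rewrite ler_piMl ?invr_ge0 ?ler0n// kpow_le1.
- exact: is_cvg_series_exp_coeff.
Qed.

Lemma is_cvg_kexp x y (t : R) : cvgn (pseries (kcoeff x y) t).
Proof.
(* Convergence at the larger radius [|t| + 1], where the exponential series dominates, covers
   negative [t] as well. *)
apply: (@is_cvg_pseries_inside _ _ (`|t| + 1)).
  by apply: is_cvg_kexp_ge0; rewrite addr_ge0.
by rewrite (ger0_norm (_ : 0 <= `|t| + 1)) ?ltrDl// addr_ge0.
Qed.

(** Formal differentiation multiplies the matrix exponential by [P]: on the left for the backward
    equation, on the right in [kcoeff_diffsr] for the forward one. *)
Lemma kcoeff_diffsl x y :
  pseries_diffs (kcoeff x y) = fun k => \sum_z P x z * kcoeff z y k.
Proof.
apply/funext => k; rewrite /pseries_diffs /kcoeff /= factS natrM invfM.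
rewrite mulrCA mulVKf ?pnatr_eq0// mulr_suml.
by apply: eq_bigr => z _; rewrite mulrA.
Qed.

Lemma kcoeff_diffsr x y :
  pseries_diffs (kcoeff x y) = fun k => \sum_z kcoeff x z k * P z y.
Proof.
apply/funext => k; rewrite /pseries_diffs /kcoeff kpowSr factS natrM invfM.
rewrite mulrCA mulVKf ?pnatr_eq0// mulr_suml.
by apply: eq_bigr => z _; rewrite mulrAC.
Qed.

Lemma cvg_pseries_diffsl x y t :
  pseries (pseries_diffs (kcoeff x y)) t @ \oo --> \sum_z P x z * kexp z y t.
Proof.
have -> : pseries (pseries_diffs (kcoeff x y)) t =
    fun n => \sum_z P x z * pseries (kcoeff z y) t n.
  rewrite kcoeff_diffsl; apply/funext => n; rewrite /pseries /series/=.
  under [RHS]eq_bigr do rewrite mulr_sumr.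
  rewrite exchange_big/=; apply: eq_bigr => k _.
  by rewrite mulr_suml; apply: eq_bigr => z _; rewrite mulrA.
by apply: cvg_finsum => z; apply: cvgM; [exact: cvg_cst|exact: is_cvg_kexp].
Qed.

Lemma cvg_pseries_diffsr x y t :
  pseries (pseries_diffs (kcoeff x y)) t @ \oo --> \sum_z kexp x z t * P z y.
Proof.
have -> : pseries (pseries_diffs (kcoeff x y)) t =
    fun n => \sum_z pseries (kcoeff x z) t n * P z y.
  rewrite kcoeff_diffsr; apply/funext => n; rewrite /pseries /series/=.
  under [RHS]eq_bigr do rewrite mulr_suml.
  rewrite exchange_big/=; apply: eq_bigr => k _.
  by rewrite mulr_suml; apply: eq_bigr => z _; rewrite mulrAC.
by apply: cvg_finsum => z; apply: cvgM; [exact: is_cvg_kexp|exact: cvg_cst].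
Qed.

(** A side condition of differentiation term by term; one derivative taken on the left reduces it to
    the series differentiated once. *)
Lemma is_cvg_pseries_diffs2 x y t :
  cvgn (pseries (pseries_diffs (pseries_diffs (kcoeff x y))) t).
Proof.
have -> : pseries (pseries_diffs (pseries_diffs (kcoeff x y))) t =
    fun n => \sum_z P x z * pseries (pseries_diffs (kcoeff z y)) t n.
  rewrite [in LHS]kcoeff_diffsl; apply/funext => n; rewrite /pseries /series/=.
  under [RHS]eq_bigr do rewrite mulr_sumr.
  rewrite exchange_big/=; apply: eq_bigr => k _.
  rewrite {1}/pseries_diffs mulr_sumr mulr_suml; apply: eq_bigr => z _.
  by rewrite /pseries_diffs; ring.
apply/cvg_ex; eexists.
apply: cvg_finsum => z; apply: cvgM; first exact: cvg_cst.
exact: cvg_pseries_diffsl.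
Qed.

Lemma kexp_derive x y (t : R) :
  is_derive t 1 (kexp x y) (limn (pseries (pseries_diffs (kcoeff x y)) t)).
Proof.
apply: (@pseries_snd_diffs _ _ (`|t| + 1)).
- exact: is_cvg_kexp.
- by apply/cvg_ex; eexists; exact: cvg_pseries_diffsl.
- exact: is_cvg_pseries_diffs2.
- by rewrite (ger0_norm (_ : 0 <= `|t| + 1)) ?ltrDl// addr_ge0.
Qed.

Lemma kexp0 x y : kexp x y 0 = (x == y)%:R.
Proof.
rewrite /kexp; apply: (cvg_lim (@Rhausdorff R)).
apply/cvg_ballP => e e0; exists 1%N => // -[|n] //= _.
rewrite /pseries /series/= big_nat_recl//= big1.
  by rewrite expr0 /kcoeff fact0 divr1 mulr1 addr0; exact: ballxx.
by move=> k _; rewrite expr0n mulr0.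
Qed.

Lemma heat0 x y : heat P 0 x y = (x == y)%:R.
Proof. by rewrite heatE oppr0 expR0 mul1r kexp0. Qed.

Lemma is_derive_expRN (t : R) : is_derive t 1 (fun s : R => expR (- s)) (- expR (- t)).
Proof.
have D1 : is_derive t 1 (fun r : R => - r) (- 1) by exact: is_deriveNid.
by have := is_derive1_comp (f := expR) (g := fun r => - r) (is_derive_expR (- t)) D1; rewrite mulrN1.
Qed.

Lemma heat_derivel x y (t : R) :
  is_derive t 1 (fun s => heat P s x y)
    (\sum_z P x z * (heat P t z y - heat P t x y)).
Proof.
have -> : (fun s => heat P s x y) = (fun s => expR (- s) * kexp x y s).
  by apply/funext => s; rewrite heatE.
have := is_derive_mul (is_derive_expRN t) (kexp_derive x y t).
rewrite (cvg_lim (@Rhausdorff R) (@cvg_pseries_diffsl x y t)).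
set d := _ + _; suff -> : d = \sum_z P x z * (heat P t z y - heat P t x y) by [].
under eq_bigr do rewrite mulrBr.
rewrite sumrB -mulr_suml P_stoch.2 mul1r /d heatE mulr_sumr mulNr.
by congr (_ - _); apply: eq_bigr => z _; rewrite heatE mulrCA.
Qed.

Lemma heat_deriver x y (t : R) :
  is_derive t 1 (fun s => heat P s x y)
    (\sum_z heat P t x z * P z y - heat P t x y).
Proof.
have -> : (fun s => heat P s x y) = (fun s => expR (- s) * kexp x y s).
  by apply/funext => s; rewrite heatE.
have := is_derive_mul (is_derive_expRN t) (kexp_derive x y t).
rewrite (cvg_lim (@Rhausdorff R) (@cvg_pseries_diffsr x y t)).
set d := _ + _.
suff -> : d = \sum_z heat P t x z * P z y - heat P t x y by [].
rewrite /d heatE mulr_sumr mulNr.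
by congr (_ - _); apply: eq_bigr => z _; rewrite heatE mulrA.
Qed.

Lemma heat_ge0 t x y : 0 <= t -> 0 <= heat P t x y.
Proof.
move=> t0; rewrite heatE mulr_ge0 ?expR_ge0//.
apply: limr_ge; first exact: is_cvg_kexp.
near=> n; rewrite /pseries /series/=; apply: sumr_ge0 => k _.
by rewrite mulr_ge0 ?exprn_ge0// divr_ge0 ?ler0n//; exact: kpow_ge0.
Unshelve. all: by end_near. Qed.

Lemma pseries_le_kexp t x y n :
  0 <= t -> pseries (kcoeff x y) t n <= kexp x y t.
Proof.
move=> t0.
have nd : {homo pseries (kcoeff x y) t : n m / (n <= m)%N >-> n <= m}.
  apply/nondecreasing_seqP => k.
  rewrite /pseries /series/= big_nat_recr//= lerDl.
  by rewrite mulr_ge0 ?exprn_ge0// divr_ge0 ?ler0n//; exact: kpow_ge0.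
exact: nondecreasing_cvgn_le nd (@is_cvg_kexp x y t) n.
Qed.

Lemma heat_ge_term t x y k :
  0 <= t -> expR (- t) * (kpow P k x y * t ^+ k / k`!%:R) <= heat P t x y.
Proof.
move=> t0; rewrite heatE ler_wpM2l ?expR_ge0//.
have := pseries_le_kexp x y k.+1 t0; apply: le_trans.
rewrite /pseries /series/= big_nat_recr//= /kcoeff mulrAC lerDr.
apply: sumr_ge0 => i _.
by rewrite mulr_ge0 ?exprn_ge0// divr_ge0 ?ler0n//; exact: kpow_ge0.
Qed.

Definition heatf (t : R) (g : X -> R) (x : X) : R := \sum_y heat P t x y * g y.

Lemma heatf0 g x : heatf 0 g x = g x.
Proof.
rewrite /heatf (bigD1 x)//= heat0 eqxx mul1r big1 ?addr0// => i /negPf.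
by rewrite eq_sym heat0 => ->; rewrite mul0r.
Qed.

Lemma heatf_derive g x (t : R) :
  is_derive t 1 (fun s => heatf s g x) (generator P (heatf t g) x).
Proof.
have -> : generator P (heatf t g) x =
    \sum_y \sum_z P x z * (heat P t z y - heat P t x y) * g y.
  rewrite exchange_big/= /generator; apply: eq_bigr => z _.
  rewrite /heatf -sumrB mulr_sumr; apply: eq_bigr => y _; ring.
apply: is_derive_finsum => y; rewrite -mulr_suml.
have := is_derive_mul (heat_derivel x y t) (is_derive_cst (g y) t 1).
by rewrite mulr0 add0r.
Qed.

(* Kolmogorov's forward equation, for an observable [F] depending on time. *)
Lemma heatf_forward (F : X -> R -> R) (dF : X -> R) o (t : R) :
  (forall z, is_derive t 1 (F z) (dF z)) ->
  is_derive t 1 (fun s => \sum_z heat P s o z * F z s)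
    (\sum_z heat P t o z * (generator P (F^~ t) z + dF z)).
Proof.
move=> DF.
have -> : \sum_z heat P t o z * (generator P (F^~ t) z + dF z) =
   \sum_z (heat P t o z * dF z +
     (\sum_w heat P t o w * P w z - heat P t o z) * F z t).
  under eq_bigr do rewrite mulrDr.
  rewrite big_split/= addrC; rewrite [RHS]big_split/=; congr (_ + _).
  under [RHS]eq_bigr do rewrite mulrBl mulr_suml.
  rewrite sumrB exchange_big/= -sumrB; apply: eq_bigr => z _.
  rewrite /generator; under [X in _ * X = _]eq_bigr do rewrite mulrBr.
  rewrite sumrB -mulr_suml P_stoch.2 mul1r mulrBr mulr_sumr; congr (_ - _).
  by apply: eq_bigr => w _; rewrite mulrA.
apply: is_derive_finsum => z.
exact: is_derive_mul (heat_deriver o z t) (DF z).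
Qed.

Lemma generator_cst (c : R) x : generator P (fun=> c) x = 0.
Proof. by rewrite /generator big1// => y _; rewrite subrr mulr0. Qed.

Lemma heatf_cst (c : R) t x : 0 <= t -> heatf t (fun=> c) x = c.
Proof.
move=> t0.
have D (s : R) : is_derive s 1 (fun s => heatf s (fun=> c) x) 0.
  have := heatf_forward (F := fun _ _ => c) x (fun z => is_derive_cst c s (1:R)).
  rewrite big1//= => z _; by rewrite generator_cst addr0 mulr0.
by rewrite (derive0_constant t0 D) heatf0.
Qed.

Lemma heat_sum1 t x : 0 <= t -> \sum_y heat P t x y = 1.
Proof.
by move=> t0; rewrite -[RHS](heatf_cst 1 x t0); apply: eq_bigr => y _; rewrite mulr1.
Qed.

Lemma heat_law t x : 0 <= t -> law (heat P t x).
Proof. by move=> t0; split=> [y|]; [exact: heat_ge0|exact: heat_sum1]. Qed.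

Lemma heatf_le t g h x : 0 <= t -> (forall y, g y <= h y) ->
  heatf t g x <= heatf t h x.
Proof. by move=> t0 gh; apply: ler_sum => y _; rewrite ler_wpM2l// heat_ge0. Qed.

(** Interpolation: [P_r P_(t+s-r) g] has zero derivative in [r]; compare [r = 0] with [r = t]. *)
Lemma heatf_semigroup t s g x : 0 <= t -> heatf (t + s) g x = heatf t (heatf s g) x.
Proof.
move=> t0.
have D (r : R) : is_derive r 1
    (fun r => \sum_z heat P r x z * heatf (t + s - r) g z) 0.
  have := heatf_forward (F := fun z r => heatf (t + s - r) g z) x
    (fun z => is_derive_reverse (t + s) r (heatf_derive g z)).
  by rewrite big1//= => z _; rewrite subrr mulr0.
have /= E := derive0_constant t0 D.
have ts : t + s - t = s by ring.
move: E; rewrite ts subr0 -/(heatf t (heatf s g) x) => ->.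
by rewrite -/(heatf 0 (heatf (t + s) g) x) heatf0.
Qed.

Lemma Gamma_ge0 f x : 0 <= Gamma P f f x.
Proof.
rewrite /Gamma mulr_ge0 ?invr_ge0// sumr_ge0// => y _.
by rewrite -mulrA mulr_ge0 ?P_stoch.1// -expr2 sqr_ge0.
Qed.

(** The defect in the chain rule for squares; it turns derivatives of second moments along the
    semigroup into energies. *)
Lemma generator_sqr f x :
  generator P (fun y => f y ^+ 2) x - 2 * f x * generator P f x = 2 * Gamma P f f x.
Proof.
rewrite /generator /Gamma mulrA mulfV ?pnatr_eq0// mul1r mulr_sumr -sumrB.
by apply: eq_bigr => y _; ring.
Qed.

Lemma Gamma_derive (F G : X -> R -> R) (dF dG : X -> R) x (t : R) :
  (forall z, is_derive t 1 (F z) (dF z)) ->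
  (forall z, is_derive t 1 (G z) (dG z)) ->
  is_derive t 1 (fun s => Gamma P (F^~ s) (G^~ s) x)
    (Gamma P (F^~ t) dG x + Gamma P dF (G^~ t) x).
Proof.
move=> DF DG; rewrite /Gamma -mulrDr; apply: is_derive_cmul.
rewrite -big_split/=; apply: is_derive_finsum => y.
have DFy := is_deriveB (DF y) (DF x).
have DGy := is_deriveB (DG y) (DG x).
exact: is_derive_mul (is_derive_cmul (P x y) DFy) DGy.
Qed.

End Heat.

(** * Graph distance and curvature *)

Section Distance.
Context {R : realType} {X : finType}.
Variable P : X -> X -> R.
Hypothesis P_stoch : stochastic P.
Hypothesis P_irr : irreducible P.

Lemma kpow1 x y : kpow P 1 x y = P x y.
Proof.
rewrite /= (bigD1 y)//= eqxx mulr1 big1 ?addr0// => i /negPf ->.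
by rewrite mulr0.
Qed.

Lemma kpow_dist_gt0 x y : 0 < kpow P (dist P x y) x y.
Proof.
rewrite /dist; case: pselect => [p|]; last by have := P_irr x y.
by case: ex_minnP.
Qed.

Lemma dist_le k x y : 0 < kpow P k x y -> (dist P x y <= k)%N.
Proof.
rewrite /dist => k0; case: pselect => [p|//].
by case: ex_minnP => m _; apply.
Qed.

Lemma distxx x : dist P x x = 0%N.
Proof. by apply/eqP; rewrite -leqn0; apply: dist_le; rewrite /= eqxx. Qed.

Lemma dist_eq0 x y : (dist P x y == 0%N) = (x == y).
Proof.
apply/idP/idP => [/eqP d0|/eqP ->]; last by rewrite distxx.
by have := kpow_dist_gt0 x y; rewrite d0 /= ltr0n; case: eqP.
Qed.

Lemma dist_triangle y x z : (dist P x z <= dist P x y + dist P y z)%N.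
Proof.
apply: dist_le; rewrite kpowD (bigD1 y)//= ltr_wpDr//.
  by apply: sumr_ge0 => w _; rewrite mulr_ge0// kpow_ge0.
by rewrite mulr_gt0// kpow_dist_gt0.
Qed.

Lemma dist_edge x y : 0 < P x y -> (dist P x y <= 1)%N.
Proof. by move=> xy; apply: dist_le; rewrite kpow1. Qed.

(** First step of a shortest path, for inductions on the distance. It is never a loop, so that
    [sparsity] controls its probability. *)
Lemma dist_succ x y k : dist P x y = k.+1 ->
  exists z, [/\ 0 < P x z, x != z & dist P z y = k].
Proof.
move=> dk; have := kpow_dist_gt0 x y; rewrite dk => /(kpowS_gt0 P_stoch)[z [Pxz kz]].
have d1 := dist_le kz; have d2 := dist_triangle z x y; have d3 := dist_edge Pxz.
have dz : dist P z y = k by lia.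
exists z; split=> //; apply/eqP => e.
by move: dk; rewrite e dz => /eqP; rewrite eqn_leq ltnn andbF.
Qed.

Lemma adjacentP x y : Defs.adjacent P x y <-> 0 < P x y /\ x != y.
Proof.
rewrite /Defs.adjacent; split=> [/eqP d1|[xy nxy]].
  have := kpow_dist_gt0 x y; rewrite d1 kpow1; split=> //.
  by rewrite -dist_eq0 d1.
by rewrite eqn_leq dist_edge// lt0n dist_eq0.
Qed.

(** Only pairs joined by one step are constrained; chaining along shortest paths gives the Lipschitz
    property for [dist]. *)
Definition lip (L : R) (g : X -> R) : Prop :=
  forall x y, 0 < P x y -> `|g y - g x| <= L.

Lemma lip_dist L g x y : lip L g -> `|g y - g x| <= L * (dist P x y)%:R.
Proof.
move=> gL; move e : (dist P x y) => k; elim: k x e => [|k IH] x e.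
  by move/eqP: e; rewrite dist_eq0 => /eqP ->; rewrite subrr normr0 mulr0.
have [z [xz _ dz]] := dist_succ e.
rewrite -natr1 mulrDr mulr1 -(subrK (g z) (g y)) -addrA.
by rewrite (le_trans (ler_normD _ _))// lerD ?IH// gL.
Qed.

Lemma lip_Gamma L g x : lip L g -> Gamma P g g x <= L ^+ 2 / 2.
Proof.
move=> gL; rewrite /Gamma mulrC ler_wpM2r ?invr_ge0//.
rewrite -[leRHS]mul1r -(P_stoch.2 x) mulr_suml; apply: ler_sum => y _.
rewrite -mulrA -expr2; have := P_stoch.1 x y; rewrite le_eqVlt.
move=> /predU1P[<-|xy]; first by rewrite !mul0r.
rewrite ler_wpM2l ?P_stoch.1// -(real_normK (num_real (g y - g x))).
by rewrite lerXn2r ?nnegrE ?normr_ge0//; [apply: le_trans (gL _ _ xy)|exact: gL].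
Qed.

(** Jumps occur at rate one and each raises the distance to [o] by at most one, so the generator
    applied to that distance is at most 1. *)
Lemma heat_dist_le t o :
  0 <= t -> \sum_y heat P t o y * (dist P o y)%:R <= t.
Proof.
move=> t0.
have D (s : R) : is_derive s 1 (fun s => \sum_y heat P s o y * (dist P o y)%:R)
    (\sum_y heat P s o y * generator P (fun z => (dist P o z)%:R) y).
  have := heatf_forward P_stoch (F := fun y _ => (dist P o y)%:R) o
    (fun y => is_derive_cst ((dist P o y)%:R : R) s 1).
  by under [X in is_derive _ _ _ X]eq_bigr do rewrite addr0.
have gen y : generator P (fun z => (dist P o z)%:R) y <= 1.
  apply: (@le_trans _ _ (\sum_z P y z)); last by rewrite P_stoch.2.
  apply: ler_sum => z _.
  have := P_stoch.1 y z; rewrite le_eqVlt => /predU1P[<-|yz].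
    by rewrite mul0r.
  rewrite ler_piMr ?P_stoch.1// lerBlDr nat1r ler_nat -addn1 addnC.
  by apply: leq_trans (dist_triangle y _ _) _; rewrite addnC leq_add2r dist_edge.
have := increment_le (c := 1) t0 D; rewrite mul1r.
rewrite -[X in _ - X]/(heatf P 0 (fun y => (dist P o y)%:R) o).
rewrite heatf0// distxx subr0; apply => s /andP[s0 _].
apply: (@le_trans _ _ (\sum_y heat P s o y)); last by rewrite heat_sum1.
apply: ler_sum => y _.
by rewrite ler_piMr ?heat_ge0.
Qed.

(** The easy half of Kantorovich duality. *)
Lemma coupling_lip_le (mu nu : X -> R) q L g : coupling mu nu q -> lip L g ->
  `|\sum_x mu x * g x - \sum_x nu x * g x| <=
    L * \sum_x \sum_y q x y * (dist P x y)%:R.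
Proof.
move=> [q0 qm qn] gL.
have -> : \sum_x mu x * g x - \sum_x nu x * g x =
    \sum_x \sum_y q x y * (g x - g y).
  rewrite -sumrB; under [RHS]eq_bigr do under eq_bigr do rewrite mulrBr.
  under [RHS]eq_bigr do rewrite sumrB.
  rewrite sumrB sumrB; congr (_ - _).
    by apply: eq_bigr => x _; rewrite -qm mulr_suml.
  by rewrite exchange_big/=; apply: eq_bigr => x _; rewrite -qn mulr_suml.
apply: le_trans (ler_norm_sum _ _ _) _; rewrite mulr_sumr.
apply: ler_sum => x _; rewrite mulr_sumr.
apply: le_trans (ler_norm_sum _ _ _) _; apply: ler_sum => y _.
rewrite normrM ger0_norm// mulrCA ler_wpM2l// distrC.
exact: lip_dist.
Qed.

Lemma W1_lip_le (mu nu : X -> R) L g : law mu -> law nu -> 0 <= L -> lip L g ->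
  `|\sum_x mu x * g x - \sum_x nu x * g x| <= L * W1 P mu nu.
Proof.
move=> [m0 m1] [n0 n1].
(* The product coupling makes the set under the infimum in [W1] nonempty. *)
have qmn : coupling mu nu (fun x y => mu x * nu y).
  split=> [x y|x|y]; first by rewrite mulr_ge0.
  - by rewrite -mulr_sumr n1 mulr1.
  - by rewrite -mulr_suml m1 mul1r.
rewrite le_eqVlt => /predU1P[<-|L0] gL.
  by have := coupling_lip_le qmn gL; rewrite !mul0r.
rewrite mulrC -ler_pdivrMr//; apply: lb_le_inf.
  exists (\sum_x \sum_y mu x * nu y * (dist P x y)%:R).
  by exists (fun x y => mu x * nu y).
move=> _ [q qc <-]; rewrite ler_pdivrMr// mulrC.
exact: coupling_lip_le qc gL.
Qed.

Lemma ollivier_ricci_lip L g t : (0 <= ollivier_ricci P)%E -> 0 <= t -> 0 <= L ->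
  lip L g -> lip L (heatf P t g).
Proof.
move=> K t0 L0 gL x y xy.
set a := `|_|.
have a0 : 0 <= a by exact: normr_ge0.
(* The curvature is a supremum that may not be attained: some rate above [- d] is available for each
   [d > 0], and [d] then tends to 0. *)
suff H d : 0 < d -> a * expR (- (d * t)) <= L.
  apply/ler_addgt0Pr => e e0.
  have d0 : 0 < e / (a * t + 1) by rewrite divr_gt0// ltr_wpDl// mulr_ge0.
  have := H _ d0; set d := e / _.
  have : 1 + - (d * t) <= expR (- (d * t)) by exact: expR_ge1Dx.
  move=> /(ler_wpM2l a0) h1 h2.
  have : a * (d * t) <= e.
    rewrite mulrCA -[leRHS](divfK (_ : a * t + 1 != 0)).
      by rewrite ler_wpM2l ?(ltW d0)// lerDl.
    by rewrite gt_eqF// ltr_wpDl// mulr_ge0.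
  lra.
move=> d0.
have : ((- d)%:E < ollivier_ricci P)%E.
  by apply: lt_le_trans K; rewrite lte_fin oppr_lt0.
move=> /ereal_sup_gt[_ [k Hk <-]]; rewrite lte_fin => dk.
have := W1_lip_le (heat_law P_stoch x t0) (heat_law P_stoch y t0) L0 gL.
rewrite -/(heatf P t g x) -/(heatf P t g y) distrC -/a => aW.
rewrite expRN ler_pdivrMr ?expR_gt0//; apply: le_trans aW _.
rewrite ler_wpM2l//; apply: le_trans (Hk t x y t0) _.
rewrite -[leRHS]mulr1 ler_pM ?expR_ge0 ?ler0n ?ler1n//; last by rewrite lern1 dist_edge.
by rewrite ler_expR ler_wpM2r// lerNl ltW.
Qed.

(** Some constant above [- d] is admissible for each [d > 0]; [d] is taken so small that the error
    [d * Gamma] is at most [e]. *)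
Lemma bakry_emery_Gamma f x : (0 <= bakry_emery P)%E ->
  2 * Gamma P f (generator P f) x <= generator P (Gamma P f f) x.
Proof.
move=> K; rewrite mulrC -ler_pdivlMr// mulrC.
apply/ler_addgt0Pr => e e0.
have G0 := Gamma_ge0 P_stoch f x.
have G1 : 0 < Gamma P f f x + 1 by rewrite ltr_wpDl.
set d := e / (Gamma P f f x + 1).
have d0 : 0 < d by rewrite divr_gt0.
have : ((- d)%:E < bakry_emery P)%E.
  by apply: lt_le_trans K; rewrite lte_fin oppr_lt0.
move=> /ereal_sup_gt[_ [k Hk <-]]; rewrite lte_fin => dk.
have := Hk f x.
have : - d * Gamma P f f x <= k * Gamma P f f x by rewrite ler_wpM2r// ltW.
have : d * Gamma P f f x <= e.
  rewrite -[leRHS](divfK (_ : Gamma P f f x + 1 != 0)) ?gt_eqF//.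
  by rewrite ler_wpM2l ?(ltW d0)// lerDl.
lra.
Qed.

Lemma Gamma_oppr f h x : Gamma P f (fun y => - h y) x = - Gamma P f h x.
Proof.
rewrite /Gamma -mulrN -sumrN; congr (_ * _); apply: eq_bigr => y _; ring.
Qed.

Lemma GammaC f h x : Gamma P f h x = Gamma P h f x.
Proof. by rewrite /Gamma; congr (_ * _); apply: eq_bigr => y _; ring. Qed.

(** Interpolation again: by the curvature inequality [P_s Gamma(P_(t-s) g)] is nondecreasing in [s],
    and its values at [0] and [t] are the two sides. *)
Lemma bakry_emery_gradient g t x : (0 <= bakry_emery P)%E -> 0 <= t ->
  Gamma P (heatf P t g) (heatf P t g) x <= heatf P t (Gamma P g g) x.
Proof.
move=> K t0.
pose u (s : R) := heatf P (t - s) g.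
have D (s : R) : is_derive s 1 (fun s => \sum_z heat P s x z * Gamma P (u s) (u s) z)
    (\sum_z heat P s x z *
      (generator P (Gamma P (u s) (u s)) z - 2 * Gamma P (u s) (generator P (u s)) z)).
  have Du z := is_derive_reverse t s (heatf_derive P_stoch g z).
  have := heatf_forward P_stoch x (fun z => Gamma_derive P z Du Du).
  set d := \sum_z _; set d' := \sum_z _; suff -> : d = d' by [].
  apply: eq_bigr => z _; congr (_ * (_ + _)).
  by rewrite [in X in _ + X]GammaC Gamma_oppr mulr_natl mulr2n opprD.
have DN (s : R) := is_deriveN (D s).
have := increment_le (c := 0) t0 DN; rewrite mul0r !fctE.
rewrite -[X in - X - _]/(heatf P t (Gamma P (u t) (u t)) x).
rewrite -[X in - _ - - X]/(heatf P 0 (Gamma P (u 0) (u 0)) x) heatf0//.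
have -> : u 0 = heatf P t g by rewrite /u subr0.
have -> : u t = g by rewrite /u subrr; apply/funext => z; rewrite heatf0.
move=> H; rewrite -subr_le0 -[leLHS]addrC; have := H _; rewrite opprK; apply.
move=> s /andP[s0 _]; rewrite oppr_le0; apply: sumr_ge0 => z _.
by rewrite mulr_ge0 ?heat_ge0// subr_ge0 bakry_emery_Gamma.
Qed.

(** The two notions of curvature meet here, and curvature enters the rest only through this
    bound. *)
Lemma curved_Gamma_le g L t x : nonneg_curved P -> 0 <= t -> 0 <= L -> lip L g ->
  Gamma P (heatf P t g) (heatf P t g) x <= L ^+ 2 / 2.
Proof.
move=> [K|K] t0 L0 gL; first by apply: lip_Gamma; exact: ollivier_ricci_lip.
apply: le_trans (bakry_emery_gradient g x K t0) _.
rewrite -[leRHS](heatf_cst P_stoch _ x t0).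
by apply: heatf_le => // y; exact: lip_Gamma.
Qed.

(** The derivative in [s] of [P_s ((P_(t-s) g)^2)] is [2 P_s Gamma(P_(t-s) g)], at most [L^2] by
    curvature. Applied to the log-density, this is the varentropy bound. *)
Lemma local_poincare g L t o : nonneg_curved P -> 0 <= t -> 0 <= L -> lip L g ->
  heatf P t (fun z => g z ^+ 2) o - heatf P t g o ^+ 2 <= L ^+ 2 * t.
Proof.
move=> K t0 L0 gL.
pose u (s : R) := heatf P (t - s) g.
have D (s : R) : is_derive s 1 (fun s => \sum_z heat P s o z * u s z ^+ 2)
    (\sum_z heat P s o z * (2 * Gamma P (u s) (u s) z)).
  have Du z := is_derive_reverse t s (heatf_derive P_stoch g z).
  have := heatf_forward P_stoch o (fun z => is_derive_sqr (Du z)).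
  set d := \sum_z _; set d' := \sum_z _; suff -> : d = d' by [].
  by apply: eq_bigr => z _; rewrite -generator_sqr mulrN.
have := increment_le (c := L ^+ 2) t0 D.
rewrite -[X in X - _ <= _]/(heatf P t (fun z => u t z ^+ 2) o).
rewrite -[X in _ - X <= _]/(heatf P 0 (fun z => u 0 z ^+ 2) o) heatf0//.
have -> : u 0 = heatf P t g by rewrite /u subr0.
have -> : u t = g by rewrite /u subrr; apply/funext => z; rewrite heatf0.
apply => s /andP[s0 st]; rewrite -[leRHS](heatf_cst P_stoch _ o s0).
apply: heatf_le => // z; rewrite mulrC -ler_pdivlMr//.
by apply: curved_Gamma_le => //; rewrite subr_ge0.
Qed.

End Distance.

(** * The Poincare inequality *)

Section Poincare.
Context {R : realType} {X : finType}.
Variables (P : X -> X -> R) (pi : X -> R).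
Hypothesis P_stoch : stochastic P.
Hypothesis P_irr : irreducible P.
Hypothesis pi_inv : invariant_law P pi.

Lemma mean_kpow k y : \sum_x pi x * kpow P k x y = pi y.
Proof.
elim: k y => [|k IH] y.
  rewrite (bigD1 y)//= eqxx mulr1 big1 ?addr0// => i /negPf ->.
  by rewrite mulr0.
under eq_bigr do rewrite kpowSr mulr_sumr.
rewrite exchange_big/= -[RHS]pi_inv.2; apply: eq_bigr => z _.
by rewrite -[in RHS]IH mulr_suml; apply: eq_bigr => x _; rewrite mulrA.
Qed.

Lemma law_exists_gt0 (mu : X -> R) : law mu -> exists x, 0 < mu x.
Proof.
move=> [m0 m1]; have [//|no] := pselect (exists x, 0 < mu x).
suff : \sum_x mu x = 0 by rewrite m1 => /eqP; rewrite oner_eq0.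
apply: big1 => x _; apply/eqP; rewrite eq_le m0 andbT leNgt.
by apply/negP => x0; apply: no; exists x.
Qed.

Lemma pi_gt0 y : 0 < pi y.
Proof.
have [x x0] := law_exists_gt0 pi_inv.1.
have [k k0] := P_irr x y.
rewrite -(mean_kpow k y) (bigD1 x)//= ltr_wpDr ?mulr_gt0//.
apply: sumr_ge0 => z _; rewrite mulr_ge0 ?pi_inv.1.1//; exact: kpow_ge0.
Qed.

Lemma pi_ge0 y : 0 <= pi y. Proof. exact: pi_inv.1.1. Qed.

Lemma mean_generator f : mean pi (generator P f) = 0.
Proof.
rewrite /mean /generator.
under eq_bigr do under eq_bigr do rewrite mulrBr.
under eq_bigr do rewrite sumrB -mulr_suml P_stoch.2 mul1r mulrBr mulr_sumr.
rewrite sumrB exchange_big/=; apply/eqP; rewrite subr_eq0; apply/eqP.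
apply: eq_bigr => z _; rewrite -[in RHS]pi_inv.2 mulr_suml.
by apply: eq_bigr => x _; rewrite mulrA.
Qed.

Lemma mean_le f g : (forall x, f x <= g x) -> mean pi f <= mean pi g.
Proof. by move=> fg; apply: ler_sum => x _; rewrite ler_wpM2l ?pi_ge0. Qed.

Lemma mean_cst c : mean pi (fun=> c) = c.
Proof. by rewrite /mean -mulr_suml pi_inv.1.2 mul1r. Qed.

Lemma mean_ge0 f : (forall x, 0 <= f x) -> 0 <= mean pi f.
Proof. by move=> f0; apply: sumr_ge0 => x _; rewrite mulr_ge0 ?pi_ge0. Qed.

Lemma mean_sqr_sub f c :
  mean pi (fun x => (f x - c) ^+ 2) = var pi f + (mean pi f - c) ^+ 2.
Proof.
set m := mean pi f.
have -> : mean pi (fun x => (f x - c) ^+ 2) =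
    \sum_x (pi x * (f x - m) ^+ 2 + (2 * (m - c) * (pi x * f x) +
       (c ^+ 2 - m ^+ 2) * pi x)).
  by apply: eq_bigr => x _; ring.
rewrite big_split big_split/= -2!mulr_sumr pi_inv.1.2 -/(mean pi f) -/m.
by rewrite -/(mean _ _) -/(var pi f); ring.
Qed.

Lemma var_le f c : var pi f <= mean pi (fun x => (f x - c) ^+ 2).
Proof. by rewrite mean_sqr_sub lerDl sqr_ge0. Qed.

Lemma mean_heatf t g : 0 <= t -> mean pi (heatf P t g) = mean pi g.
Proof.
move=> t0.
have D (s : R) : is_derive s 1 (fun s => mean pi (heatf P s g)) 0.
  rewrite -(mean_generator (heatf P s g)); apply: is_derive_finsum => x.
  by apply: is_derive_cmul; exact: heatf_derive.
rewrite (derive0_constant t0 D); apply: eq_bigr => x _.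
by rewrite heatf0.
Qed.

(** From [(a - b)^2 / 2 <= a^2 + b^2], both ends of a stationary step having law [pi]. It serves to
    bound [trel] from below. *)
Lemma mean_Gamma_le f : mean pi (Gamma P f f) <= 2 * var pi f.
Proof.
set m := mean pi f.
apply: (@le_trans _ _ (\sum_x \sum_y pi x * P x y *
   ((f y - m) ^+ 2 + (f x - m) ^+ 2))).
  apply: ler_sum => x _; rewrite /Gamma mulrCA mulr_sumr mulr_sumr.
  apply: ler_sum => y _; rewrite -!mulrA mulrCA ler_wpM2l ?pi_ge0//.
  rewrite mulrCA ler_wpM2l ?P_stoch.1// -subr_ge0.
  have -> : (f y - m) ^+ 2 + (f x - m) ^+ 2 - 2^-1 * ((f y - f x) * (f y - f x)) =
     ((f y - m) + (f x - m)) ^+ 2 / 2 by field.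
  by rewrite divr_ge0 ?sqr_ge0.
under eq_bigr do under eq_bigr do rewrite mulrDr.
under eq_bigr do rewrite big_split/=.
rewrite big_split/= exchange_big/= mulr_natl mulr2n lerD//.
  by apply: ler_sum => y _; rewrite -mulr_suml pi_inv.2.
by apply: ler_sum => x _; rewrite -mulr_suml -mulr_sumr P_stoch.2 mulr1.
Qed.

(** Ensures that the infimum defining [trel] is over a nonempty set, so any constant will do: the
    energy bounds each edge increment, hence the oscillation along paths from [x0]. *)
Lemma poincare_exists :
  exists c, forall f, var pi f <= c * mean pi (Gamma P f f).
Proof.
have [x0 _] := law_exists_gt0 pi_inv.1.
(* Dominates the inverse weight of every edge; pairs of weight zero contribute [0^-1 = 0]. *)
pose K := \sum_x \sum_y (pi x * P x y)^-1.
pose D := \sum_x (dist P x0 x)%:R : R.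
have K0 : 0 <= K.
  apply: sumr_ge0 => x _; apply: sumr_ge0 => y _.
  by rewrite invr_ge0 mulr_ge0 ?pi_ge0// P_stoch.1.
exists (2 * K * D ^+ 2) => f; set E := mean _ _.
have E0 : 0 <= E by apply: mean_ge0 => x; exact: Gamma_ge0.
have S0 : 0 <= 2 * K * E by rewrite !mulr_ge0.
have fL : lip P (Num.sqrt (2 * K * E)) f.
  move=> x y xy; rewrite -sqrtr_sqr ler_sqrt//.
  have pxy : 0 < pi x * P x y by rewrite mulr_gt0// pi_gt0.
  have h1 : pi x * P x y * (f y - f x) ^+ 2 <= 2 * E.
    rewrite /E /mean (bigD1 x)//= mulrDr.
    apply: ler_wpDr.
      rewrite mulr_ge0// sumr_ge0// => z _.
      by rewrite mulr_ge0 ?pi_ge0//; exact: Gamma_ge0.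
    have -> : 2 * (pi x * Gamma P f f x) =
        pi x * \sum_y P x y * (f y - f x) * (f y - f x).
      by rewrite /Gamma mulrCA [2 * (_ * _)]mulrA mulfV ?mul1r// pnatr_eq0.
    rewrite -mulrA ler_wpM2l ?pi_ge0//.
    rewrite (bigD1 y)//= -mulrA -expr2 lerDl sumr_ge0// => z _.
    by rewrite -mulrA mulr_ge0 ?P_stoch.1// -expr2 sqr_ge0.
  have h2 : (pi x * P x y)^-1 <= K.
    rewrite /K (bigD1 x)//= (bigD1 y)//= -addrA lerDl addr_ge0//.
      by apply: sumr_ge0 => z _; rewrite invr_ge0 mulr_ge0 ?pi_ge0 ?P_stoch.1.
    apply: sumr_ge0 => w _; apply: sumr_ge0 => z _.
    by rewrite invr_ge0 mulr_ge0 ?pi_ge0 ?P_stoch.1.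
  apply: (@le_trans _ _ ((pi x * P x y)^-1 * (2 * E))).
    by rewrite mulrC ler_pdivlMr// mulrC.
  by rewrite mulrAC [leRHS]mulrC ler_wpM2r// mulr_ge0.
apply: le_trans (var_le f (f x0)) _.
have -> : 2 * K * D ^+ 2 * E = mean pi (fun=> (Num.sqrt (2 * K * E) * D) ^+ 2).
  by rewrite mean_cst exprMn sqr_sqrtr//; ring.
apply: mean_le => x; rewrite -(real_normK (num_real (f x - f x0))).
rewrite lerXn2r ?nnegrE ?normr_ge0//.
  by rewrite mulr_ge0 ?sqrtr_ge0// sumr_ge0.
apply: le_trans (lip_dist P_stoch P_irr x0 x fL) _.
rewrite ler_wpM2l ?sqrtr_ge0// /D (bigD1 x)//= lerDl sumr_ge0//.
Qed.

Hypothesis card_ge2 : (2 <= #|X|)%N.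

Lemma exists_var_gt0 : exists f, 0 < var pi f.
Proof.
have [x [y xy]] : exists x, exists y, x != y :> X.
  have /card_gt1P [x [y [_ _ xy]]] : (1 < #|[pred x : X | true]|)%N by [].
  by exists x, y.
exists (fun z => (z == x)%:R).
have -> : var pi (fun z => (z == x)%:R) =
    \sum_z pi z * ((z == x)%:R - pi x) ^+ 2.
  apply: eq_bigr => z _; congr (_ * (_ - _) ^+ 2).
  rewrite /mean (bigD1 x)//= eqxx mulr1 big1 ?addr0// => i /negPf ->.
  by rewrite mulr0.
rewrite (bigD1 y)//= eq_sym (negPf xy) sub0r sqrrN ltr_wpDr//.
  by apply: sumr_ge0 => z _; rewrite mulr_ge0 ?pi_ge0// sqr_ge0.
by rewrite mulr_gt0 ?exprn_gt0 ?pi_gt0.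
Qed.

Lemma poincare_ge_half c :
  (forall f, var pi f <= c * mean pi (Gamma P f f)) -> 2^-1 <= c.
Proof.
move=> cP; rewrite leNgt; apply/negP => c2.
have [f f0] := exists_var_gt0.
have := cP f; have := mean_Gamma_le f.
have : 0 <= mean pi (Gamma P f f) by apply: mean_ge0 => x; exact: Gamma_ge0.
rewrite le_eqVlt => /predU1P[<-|E0]; first by rewrite mulr0; lra.
have : c * mean pi (Gamma P f f) < 2^-1 * mean pi (Gamma P f f) by rewrite ltr_pM2r.
lra.
Qed.

(** Keeps the relaxation time away from zero, so that bounded time shifts can be absorbed in the
    window. *)
Lemma trel_ge_half : 2^-1 <= trel P pi.
Proof.
by apply: lb_le_inf => [|c]; [exact: poincare_exists|exact: poincare_ge_half].
Qed.

Lemma trel_gt0 : 0 < trel P pi.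
Proof. by apply: lt_le_trans trel_ge_half; rewrite invr_gt0. Qed.

(** The infimum is attained: divide by the energy or, when it vanishes, use any admissible
    constant. *)
Lemma trel_poincare f : var pi f <= trel P pi * mean pi (Gamma P f f).
Proof.
set E := mean _ _.
have E0 : 0 <= E by apply: mean_ge0 => x; exact: Gamma_ge0.
have [c cP] := poincare_exists.
move: E0; rewrite le_eqVlt => /predU1P[E0|E0].
  by rewrite -E0 mulr0; have := cP f; rewrite -/E -E0 mulr0.
rewrite -ler_pdivrMr//; apply: lb_le_inf; first by exists c.
by move=> d /(_ f); rewrite ler_pdivrMr.
Qed.

(** Along the semigroup the variance has derivative [-2 E[Gamma]], by invariance of [pi], and the
    Poincare inequality turns this into exponential decay. *)
Lemma var_heatf_le t g : 0 <= t ->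
  var pi (heatf P t g) <= expR (- (2 * t / trel P pi)) * var pi g.
Proof.
move=> t0; set T := trel P pi; set c := mean pi g.
have T0 : 0 < T := trel_gt0.
pose v (s : R) := mean pi (fun x => (heatf P s g x - c) ^+ 2).
have vE s : 0 <= s -> v s = var pi (heatf P s g).
  by move=> s0; rewrite /v /var mean_heatf.
have Dv (s : R) : is_derive s 1 v (- 2 * mean pi (Gamma P (heatf P s g) (heatf P s g))).
  set u := heatf P s g.
  have -> : - 2 * mean pi (Gamma P u u) =
      \sum_x pi x * (2 * (u x - c) * generator P u x).
    transitivity (mean pi (generator P (fun x => (u x - c) ^+ 2))
      - 2 * mean pi (Gamma P u u)).
      by rewrite mean_generator sub0r mulNr.
    rewrite /mean mulr_sumr -sumrB; apply: eq_bigr => x _.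
    rewrite mulrCA -mulrBr; congr (_ * _).
    have -> : Gamma P u u x = Gamma P (fun y => u y - c) (fun y => u y - c) x.
      by rewrite /Gamma; congr (_ * _); apply: eq_bigr => y _; ring.
    rewrite -generator_sqr opprB addrC subrK; congr (_ * _).
    by apply: eq_bigr => y _; ring.
  apply: is_derive_finsum => x; apply: is_derive_cmul; apply: is_derive_sqr.
  have := is_deriveB (heatf_derive P_stoch g x s) (is_derive_cst c s (1:R)).
  by rewrite subr0.
(* Integrating factor: [w] is nonincreasing on nonnegative times. *)
pose w (s : R) := expR (2 / T * s) * v s.
have De (s : R) : is_derive s 1 (fun s => expR (2 / T * s)) (expR (2 / T * s) * (2 / T)).
  have D1 : is_derive s 1 (fun r : R => 2 / T * r) (2 / T).
    by have := is_derive_cmul (2 / T) (is_derive_id s (1:R)); rewrite mulr1.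
  exact: (is_derive1_comp (f := expR) (g := fun r => 2 / T * r) (is_derive_expR _) D1).
have Dw s := is_derive_mul (De s) (Dv s).
have := increment_le (c := 0) t0 Dw; rewrite mul0r => H.
have {H} : expR (2 / T * t) * v t - expR (2 / T * 0) * v 0 <= 0.
  apply: H => s /andP[s0 _].
  rewrite -[X in _ + X]mulrA -mulrDr pmulr_rle0 ?expR_gt0// vE//.
  have := trel_poincare (heatf P s g); rewrite -/T => h.
  have : var pi (heatf P s g) / T <= mean pi (Gamma P (heatf P s g) (heatf P s g)).
    by rewrite ler_pdivrMr// mulrC.
  lra.
rewrite mulr0 expR0 mul1r subr_le0 vE// vE// => h.
rewrite expRN mulrC ler_pdivlMr ?expR_gt0// mulrC mulrAC.
suff <- : var pi (heatf P 0 g) = var pi g by [].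
by congr var; apply/funext => x; rewrite heatf0.
Qed.

End Poincare.

(** * Mixing times *)

Section Mixing.
Context {R : realType} {X : finType}.

Lemma le_dTV (mu nu : X -> R) (A : {set X}) :
  `|\sum_(x in A) mu x - \sum_(x in A) nu x| <= dTV mu nu.
Proof.
exact: (le_bigmax 0 (fun A : {set X} =>
  `|\sum_(x in A) mu x - \sum_(x in A) nu x|)).
Qed.

Lemma dTV_le (mu nu : X -> R) e : 0 <= e ->
  (forall A : {set X}, `|\sum_(x in A) mu x - \sum_(x in A) nu x| <= e) ->
  dTV mu nu <= e.
Proof. by move=> e0 H; apply: bigmax_le. Qed.

Variables (P : X -> X -> R) (pi : X -> R).

Definition mixed eps t : Prop := 0 <= t /\ forall x, dTV (heat P t x) pi <= eps.

Lemma mixedP eps t : 0 <= eps -> mixed eps t <->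
  0 <= t /\ \big[Num.max/0]_x dTV (heat P t x) pi <= eps.
Proof.
move=> e0; split=> -[t0 H]; split=> //; first exact: bigmax_le.
by move=> x; apply: le_trans H; exact: (le_bigmax 0 (fun x => dTV (heat P t x) pi)).
Qed.

Lemma tmix_le eps t : 0 <= eps -> mixed eps t -> tmix P pi eps <= t.
Proof.
by move=> e0 /(mixedP _ e0) H; apply: ge_inf => //; exists 0 => s [].
Qed.

Hypothesis P_stoch : stochastic P.
Hypothesis P_irr : irreducible P.
Hypothesis pi_inv : invariant_law P pi.
Hypothesis card_ge2 : (2 <= #|X|)%N.

Local Notation T := (trel P pi).

(* A part of mass at least [1 - delta] of the law at time [t] has a density
   bounded by [e^K], and the L2 contraction applies to that part. *)
Lemma dTV_heat_le t s o K delta (B : {pred X}) : 0 <= t -> 0 <= s ->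
  (forall x, x \in B -> heat P t o x <= expR K * pi x) ->
  \sum_(x | x \notin B) heat P t o x <= delta ->
  dTV (heat P (t + s) o) pi <= delta + expR (K / 2 - s / T).
Proof.
move=> t0 s0 HB Hd.
have T0 : 0 < T by apply: trel_gt0.
have d0 : 0 <= delta.
  by apply: le_trans Hd; apply: sumr_ge0 => x _; exact: heat_ge0.
apply: dTV_le => [|A]; first by rewrite addr_ge0 ?expR_ge0.
pose g x : R := (x \in A)%:R.
have g01 x : 0 <= g x <= 1 by rewrite ler0n lern1 leq_b1.
set u := heatf P s g; set c := mean pi g.
have u0 x : 0 <= u x.
  by rewrite -(heatf_cst P_stoch 0 x s0) heatf_le// => y; have /andP[] := g01 y.
have u1 x : u x <= 1.
  by rewrite -(heatf_cst P_stoch 1 x s0) heatf_le// => y; have /andP[] := g01 y.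
have c0 : 0 <= c by apply: (mean_ge0 pi_inv) => x; have /andP[] := g01 x.
have c1 : c <= 1.
  by rewrite -(mean_cst pi_inv 1); apply: (mean_le pi_inv) => x; have /andP[] := g01 x.
have E1 : \sum_(x in A) heat P (t + s) o x = heatf P t u o.
  rewrite /u -heatf_semigroup// /heatf [LHS]big_mkcond/=; apply: eq_bigr => x _.
  by rewrite /g; case: (x \in A); rewrite ?mulr1 ?mulr0.
have E2 : \sum_(x in A) pi x = c.
  rewrite /c /mean [LHS]big_mkcond/=; apply: eq_bigr => x _.
  by rewrite /g; case: (x \in A); rewrite ?mulr1 ?mulr0.
have -> : \sum_(x in A) heat P (t + s) o x - \sum_(x in A) pi x =
    \sum_x heat P t o x * (u x - c).
  rewrite E1 E2 -[X in _ - X](heatf_cst P_stoch _ o t0) /heatf -sumrB.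
  by apply: eq_bigr => x _; rewrite mulrBr.
apply: le_trans (ler_norm_sum _ _ _) _.
(* Off [B], the numbers [u x] and [c] lie in [[0, 1]] and the mass is at most [delta]; on [B] the
   variance bound is used. *)
rewrite (bigID [in B])/= addrC; apply: lerD.
  apply: le_trans Hd; apply: ler_sum => x _.
  rewrite normrM ger0_norm ?heat_ge0// ler_piMr ?heat_ge0//.
  by have := u0 x; have := u1 x; rewrite ler_norml; lra.
set a := expR (K / 2 - s / T).
have a0 : 0 < a := expR_gt0 _.
have varu : expR K * var pi u <= a ^+ 2.
  have -> : a ^+ 2 = expR K * expR (- (2 * s / T)).
    by rewrite /a expr2 -!expRD; congr expR; field; rewrite gt_eqF.
  rewrite ler_wpM2l ?expR_ge0//.
  apply: le_trans (var_heatf_le P_stoch P_irr pi_inv card_ge2 g s0) _.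
  rewrite ler_piMr ?expR_ge0//; apply: le_trans (var_le pi_inv g 0) _.
  rewrite -[leRHS](mean_cst pi_inv); apply: (mean_le pi_inv) => x.
  by have /andP[? ?] := g01 x; rewrite subr0 expr_le1.
(* Cauchy-Schwarz in the form [h |v| <= (a h + h v^2 / a) / 2], followed by [h <= e^K pi] on [B];
   [a^2] is the bound just found for [e^K Var(u)]. *)
apply: (@le_trans _ _ (\sum_x 2^-1 * (a * heat P t o x +
    a^-1 * (expR K * (pi x * (u x - c) ^+ 2))))); last first.
  have -> : \sum_x 2^-1 * (a * heat P t o x +
      a^-1 * (expR K * (pi x * (u x - c) ^+ 2))) =
      2^-1 * (a * (\sum_x heat P t o x) + a^-1 * (expR K * var pi u)).
    by rewrite -mulr_sumr big_split/= -!mulr_sumr /var mean_heatf.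
  rewrite heat_sum1// mulr1.
  have : a^-1 * (expR K * var pi u) <= a.
    by rewrite mulrC ler_pdivrMr// -expr2.
  lra.
rewrite [leLHS]big_mkcond/=; apply: ler_sum => x _; case: ifPn => xB; last first.
  have ai0 : 0 <= a^-1 by rewrite invr_ge0 ltW.
  apply: mulr_ge0 => //; apply: addr_ge0; apply: mulr_ge0 => //.
  - exact: ltW.
  - exact: heat_ge0.
  - by rewrite mulr_ge0 ?expR_ge0// mulr_ge0 ?sqr_ge0// pi_inv.1.1.
rewrite normrM ger0_norm ?heat_ge0//.
set h := heat P t o x; set v := u x - c.
have h0 : 0 <= h by exact: heat_ge0.
have vv : v ^+ 2 = `|v| ^+ 2 by rewrite real_normK// num_real.
apply: (@le_trans _ _ (2^-1 * (a * h + a^-1 * (h * v ^+ 2)))).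
  have -> : 2^-1 * (a * h + a^-1 * (h * v ^+ 2)) =
      h * `|v| + 2^-1 * a^-1 * h * (a - `|v|) ^+ 2.
    by rewrite vv; field; rewrite gt_eqF.
  rewrite lerDl mulr_ge0 ?sqr_ge0// mulr_ge0// mulr_ge0 ?invr_ge0//.
  exact: ltW.
rewrite ler_wpM2l// lerD2l ler_wpM2l ?invr_ge0 ?(ltW a0)//.
by rewrite mulrA ler_wpM2r ?sqr_ge0// HB.
Qed.

(** At time 0 the law is a point mass, of density at most [e^K], so [dTV_heat_le] applies with
    nothing discarded. *)
Lemma mixed_of_pi_ge K eps : 0 <= K -> (forall x, expR (- K) <= pi x) ->
  0 < eps <= 1 -> mixed eps (T * (K / 2 - ln eps)).
Proof.
move=> K0 piK /andP[e0 e1].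
have T0 : 0 < T by apply: trel_gt0.
have s0 : 0 <= T * (K / 2 - ln eps).
  by rewrite mulr_ge0 ?(ltW T0)// addr_ge0 ?divr_ge0// oppr_ge0 ln_le0.
split=> // x.
have := @dTV_heat_le 0 (T * (K / 2 - ln eps)) x K 0 predT (lexx 0) s0.
rewrite add0r add0r mulrAC mulfV ?gt_eqF// mul1r opprB addrCA subrr addr0.
rewrite lnK//; apply; last by rewrite big_pred0.
move=> y _; rewrite heat0 -[leLHS]mulr1; apply: le_trans (_ : expR K * expR (- K) <= _).
  by rewrite expRN mulfV ?gt_eqF ?expR_gt0// mulr1 lern1 leq_b1.
by rewrite ler_wpM2l ?expR_ge0.
Qed.

(** Crude, but enough for the infima defining the mixing times to range over nonempty sets. *)
Lemma exists_pi_ge : exists2 K, 0 <= K & forall x, expR (- K) <= pi x.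
Proof.
have pi0 := pi_gt0 P_stoch P_irr pi_inv.
exists (\sum_x - ln (pi x)).
  apply: sumr_ge0 => x _; rewrite oppr_ge0 ln_le0//.
  rewrite -pi_inv.1.2 (bigD1 x)//= lerDl sumr_ge0// => y _; exact: ltW.
move=> x; rewrite -[leRHS]lnK ?posrE// ler_expR.
rewrite (bigD1 x)//= opprD opprK gerDl oppr_le0.
apply: sumr_ge0 => y _; rewrite oppr_ge0 ln_le0//.
by rewrite -pi_inv.1.2 (bigD1 y)//= lerDl sumr_ge0// => z _; exact: ltW.
Qed.

Lemma mixed_exists eps : 0 < eps <= 1 -> exists t, mixed eps t.
Proof.
by move=> e; have [K K0 HK] := exists_pi_ge; eexists; exact: mixed_of_pi_ge K0 HK e.
Qed.

(** Stands in for attainment of the infimum, which would require continuity in time. *)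
Lemma mixed_near_tmix eps eta : 0 < eps <= 1 -> 0 < eta ->
  exists2 t, mixed eps t & tmix P pi eps <= t < tmix P pi eps + eta.
Proof.
move=> /andP[e0 e1] eta0.
have [|t /mixedP-/(_ (ltW e0)) tm tl] := @inf_adherent _ [set t | 0 <= t /\
   \big[Num.max/0]_x dTV (heat P t x) pi <= eps] eta eta0.
  split; last by exists 0 => s [].
  have [|t tm] := @mixed_exists eps; first by rewrite e0.
  by exists t; exact/(mixedP _ (ltW e0)).
by exists t => //; rewrite tl tmix_le// ltW.
Qed.

Lemma tmix_anti eps eps' : 0 < eps <= 1 -> eps <= eps' ->
  tmix P pi eps' <= tmix P pi eps.
Proof.
move=> /andP[e0 e1] ee; apply: lb_le_inf => [|t].
  have [|t tm] := @mixed_exists eps; first by rewrite e0.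
  by exists t; exact/(mixedP _ (ltW e0)).
move=> /(mixedP _ (ltW e0))[t0 H]; apply: tmix_le; first by apply: le_trans ee; exact: ltW.
by split=> // x; apply: le_trans ee.
Qed.

(* Until its first jump the chain sits at [x]. *)
Lemma tmix_ge eps x : 0 < eps <= 1 -> 1 - pi x - eps <= tmix P pi eps.
Proof.
move=> /andP[e0 e1]; apply: lb_le_inf => [|t].
  have [|t tm] := @mixed_exists eps; first by rewrite e0.
  by exists t; exact/(mixedP _ (ltW e0)).
move=> /(mixedP _ (ltW e0))[t0 /(_ x) H].
have := le_dTV (heat P t x) pi [set x]; rewrite !big_set1 ler_norml.
have := heat_ge_term P_stoch x x 0 t0.
rewrite expr0 fact0 divr1 mulr1 /= eqxx mulr1.
have := expR_ge1Dx (- t); lra.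
Qed.

(** * Diameter of a chain with symmetric support *)

Hypothesis P_sym : symmetric_support P.

Lemma kpow_sym k x y : 0 < kpow P k x y -> 0 < kpow P k y x.
Proof.
elim: k x y => [|k IH] x y; first by rewrite /= eq_sym.
move=> /(kpowS_gt0 P_stoch)[z [Pxz kz]].
rewrite kpowSr (bigD1 z)//= ltr_wpDr//.
  by apply: sumr_ge0 => w _; rewrite mulr_ge0 ?P_stoch.1 ?kpow_ge0.
by apply: mulr_gt0; [exact: IH|exact: (P_sym x z).1].
Qed.

Lemma dist_sym x y : dist P x y = dist P y x.
Proof.
by apply/eqP; rewrite eqn_leq !dist_le//; apply: kpow_sym; exact: kpow_dist_gt0.
Qed.

Lemma lip_dist_from o : lip P 1 (fun x => (dist P o x)%:R).
Proof.
move=> x y xy; rewrite ler_norml.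
have h1 : ((dist P o y)%:R : R) <= (dist P o x)%:R + 1.
  rewrite natr1 ler_nat -addn1.
  by apply: leq_trans (dist_triangle P_stoch P_irr x _ _) _; rewrite leq_add2l dist_edge.
have h2 : ((dist P o x)%:R : R) <= (dist P o y)%:R + 1.
  rewrite natr1 ler_nat -addn1.
  apply: leq_trans (dist_triangle P_stoch P_irr y _ _) _.
  by rewrite leq_add2l dist_edge//; exact: (P_sym x y).1.
by apply/andP; split; lra.
Qed.

(* The ball of radius [2t/eps] has positive stationary mass, whereas the
   Poincare inequality concentrates the distance around its mean. *)
Lemma mean_dist_le eps t o : 0 < eps <= 1 -> mixed (1 - eps) t ->
  mean pi (fun x => (dist P o x)%:R) <= 2 * t / eps + Num.sqrt (T / eps).
Proof.
move=> /andP[e0 e1] [t0 tv].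
have T0 : 0 < T by apply: trel_gt0.
set d := fun x => (dist P o x)%:R; set m := mean pi d; set a := 2 * t / eps.
rewrite leNgt; apply/negP => ma.
have Te0 : 0 <= T / eps by rewrite divr_ge0// ltW.
have ma0 : 0 < m - a by have := sqrtr_ge0 (T / eps); lra.
have a0 : 0 <= a by rewrite divr_ge0 ?mulr_ge0// ltW.
pose A : {set X} := [set x | d x <= a]%SET.
(* Markov's inequality for the distance, whose mean is at most [t]. At [t = 0] the radius [a] is 0
   and the chain still sits at [o]. *)
have far : \sum_(x | x \notin A) heat P t o x <= eps / 2.
  have [t0'|/eqP tn0] := eqVneq t 0.
    rewrite big1 ?divr_ge0// ?ltW// => x; rewrite inE -ltNge => ax.
    rewrite t0' heat0; case: eqP => // ox; move: ax.
    by rewrite /d -ox distxx ltNge a0.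
  have a1 : 0 < a.
    rewrite divr_gt0// mulr_gt0// lt_neqAle t0 andbT; apply/eqP => te; exact: tn0.
  rewrite -(ler_pM2l a1); apply: (@le_trans _ _ t).
    apply: le_trans (heat_dist_le P_stoch P_irr o t0).
    rewrite mulr_sumr big_mkcond/=; apply: ler_sum => x _; case: ifPn.
      by rewrite inE -ltNge => ax; rewrite mulrC ler_wpM2l ?heat_ge0// ltW.
    by move=> _; rewrite mulr_ge0 ?heat_ge0.
  have -> : a * (eps / 2) = t by rewrite /a; field; rewrite gt_eqF.
  exact: lexx.
(* The law at time [t] gives [A] mass at least [1 - eps/2] and is within [1 - eps] of [pi]. *)
have piA : eps / 2 <= \sum_(x in A) pi x.
  have := le_dTV (heat P t o) pi A; have := tv o.
  have := heat_sum1 P_stoch o t0; rewrite (bigID [in A])/= => h.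
  rewrite ler_norml; lra.
have v1 : var pi d <= T / 2.
  apply: le_trans (trel_poincare P_stoch P_irr pi_inv d) _.
  rewrite ler_wpM2l ?(ltW T0)// -[leRHS](mean_cst pi_inv); apply: (mean_le pi_inv) => x.
  have := lip_Gamma P_stoch x (lip_dist_from o); rewrite expr1n mul1r; exact.
(* Chebyshev: on [A] the distance is below its mean by at least [m - a]. *)
have v2 : eps / 2 * (m - a) ^+ 2 <= var pi d.
  apply: (@le_trans _ _ (\sum_(x in A) pi x * (m - a) ^+ 2)).
    by rewrite -mulr_suml ler_wpM2r ?sqr_ge0.
  rewrite big_mkcond/=; apply: ler_sum => x _; case: ifPn => [|_]; last first.
    by rewrite mulr_ge0 ?sqr_ge0// pi_inv.1.1.
  rewrite inE => xa; rewrite ler_wpM2l ?pi_inv.1.1// -/m -[leRHS]sqrrN opprB.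
  by rewrite lerXn2r ?nnegrE ?(ltW ma0)//; [apply: le_trans (ltW ma0) _|]; rewrite lerD2l lerN2.
have v3 : (m - a) ^+ 2 <= T / eps.
  rewrite ler_pdivlMr//; have := le_trans v2 v1; lra.
have : Num.sqrt (T / eps) ^+ 2 < (m - a) ^+ 2.
  by rewrite ltrXn2r ?nnegrE ?sqrtr_ge0 ?(ltW ma0)//; lra.
by rewrite sqr_sqrtr// ltNge v3.
Qed.

(** Average [d(x,y) <= d(x,z) + d(y,z)] over [z] of law [pi]. *)
Lemma dist_le_mixed eps t x y : 0 < eps <= 1 -> mixed (1 - eps) t ->
  (dist P x y)%:R <= 2 * (2 * t / eps + Num.sqrt (T / eps)).
Proof.
move=> e tm; have hx := mean_dist_le x e tm; have hy := mean_dist_le y e tm.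
rewrite -[leLHS](mean_cst pi_inv).
apply: (@le_trans _ _ (mean pi (fun z => (dist P x z)%:R) +
                       mean pi (fun z => (dist P y z)%:R))); last by lra.
rewrite /mean -big_split/=; apply: ler_sum => z _; rewrite -mulrDr.
rewrite ler_wpM2l ?pi_inv.1.1// -natrD ler_nat (dist_sym y z).
exact: dist_triangle.
Qed.

End Mixing.

(** * Sparsity and lower bounds on the heat kernel *)

Section Sparsity.
Context {R : realType} {X : finType}.
Variable P : X -> X -> R.
Hypothesis P_stoch : stochastic P.
Hypothesis P_irr : irreducible P.
Hypothesis P_sym : symmetric_support P.
Hypothesis card_ge3 : (3 <= #|X|)%N.

Local Notation Delta := (sparsity P).

Lemma sparsity_ge x y : 0 < P x y -> x != y -> (P x y)^-1 <= Delta.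
Proof.
move=> xy nxy.
have adj : Defs.adjacent P x y by apply/(adjacentP P_irr).
exact: (@le_bigmax_cond _ R _ 0 (x, y) (fun e : X * X => Defs.adjacent P e.1 e.2)
  (fun e => (P e.1 e.2)^-1) adj).
Qed.

Lemma exists_neighbour x : exists y, 0 < P x y /\ x != y.
Proof.
have [y yx] : exists y, y != x.
  have /card_gt1P[a [b [_ _ ab]]] : (1 < #|[pred z : X | true]|)%N.
    exact: ltnW card_ge3.
  by have [ax|] := eqVneq a x; [exists b; rewrite -ax eq_sym|exists a].
have : (0 < dist P x y)%N by rewrite lt0n (dist_eq0 P_irr) eq_sym.
case e : (dist P x y) => [//|k] _.
by have [z [? ? _]] := dist_succ P_stoch P_irr e; exists z.
Qed.

(* Otherwise every vertex has a single neighbour, and a connected component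
   has at most two points. *)
Lemma sparsity_ge2 : 2 <= Delta.
Proof.
rewrite leNgt; apply/negP => D2.
have P2 x y : 0 < P x y -> x != y -> 2^-1 < P x y.
  move=> xy nxy; rewrite -[ltRHS]invrK ltf_pV2 ?posrE ?invr_gt0//.
  exact: le_lt_trans (sparsity_ge xy nxy) D2.
have uniq x y z : 0 < P x y -> x != y -> 0 < P x z -> x != z -> y = z.
  move=> xy nxy xz nxz; apply/eqP; apply/negP => /negP yz.
  have := P_stoch.2 x; rewrite (bigD1 y)//= (bigD1 z)/=; last by rewrite eq_sym.
  have : 0 <= \sum_(i | (i != y) && (i != z)) P x i.
    by apply: sumr_ge0 => i _; exact: P_stoch.1.
  have := P2 _ _ xy nxy; have := P2 _ _ xz nxz; lra.
have [x _] : exists x : X, true.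
  have /card_gt0P[x _] : (0 < #|[pred z : X | true]|)%N.
    exact: leq_trans card_ge3.
  by exists x.
have [y [xy nxy]] := exists_neighbour x.
have closed a b : 0 < P a b -> a \in [set x; y]%SET -> b \in [set x; y]%SET.
  move=> ab; rewrite !inE => /orP[]/eqP ea; subst a.
    have [->|xb] := eqVneq b x; first by rewrite ?eqxx.
    have -> : b = y by apply: (uniq x) => //; rewrite eq_sym.
    by rewrite ?eqxx ?orbT.
  have [->|yb] := eqVneq b y; first by rewrite ?eqxx ?orbT.
  have -> : b = x.
    apply: (uniq y) => //; first by rewrite eq_sym.
      exact: (P_sym x y).1.
    by rewrite eq_sym.
  by rewrite ?eqxx.
have reach k a z : dist P a z = k -> a \in [set x; y]%SET -> z \in [set x; y]%SET.
  elim: k a => [|k IH] a e ain.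
    by move/eqP: e; rewrite (dist_eq0 P_irr) => /eqP <-.
  have [b [ab _ bz]] := dist_succ P_stoch P_irr e.
  by apply: (IH b bz); exact: closed ab ain.
have : (#|X| <= #|[set x; y]%SET|)%N.
  apply/subset_leq_card/fintype.subsetP => z _.
  by apply: (reach _ x z erefl); rewrite !inE eqxx.
by rewrite cards2 nxy leqNgt card_ge3.
Qed.

Lemma sparsity_gt0 : 0 < Delta.
Proof. exact: lt_le_trans sparsity_ge2. Qed.

Lemma inv_sparsity_le x y : 0 < P x y -> x != y -> Delta^-1 <= P x y.
Proof.
move=> xy nxy; rewrite -[leRHS]invrK lef_pV2 ?posrE ?invr_gt0 ?sparsity_gt0//.
exact: sparsity_ge.
Qed.

(** Each step of a shortest path has probability at least [1/Delta]. *)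
Lemma kpow_dist_ge x y : Delta^-1 ^+ dist P x y <= kpow P (dist P x y) x y.
Proof.
move e : (dist P x y) => k; elim: k x e => [|k IH] x e.
  by move/eqP: e; rewrite (dist_eq0 P_irr) => /eqP ->; rewrite expr0 /= eqxx.
have [z [xz nxz dz]] := dist_succ P_stoch P_irr e.
rewrite exprS /= (bigD1 z)//=; apply: ler_wpDr.
  by apply: sumr_ge0 => w _; rewrite mulr_ge0 ?P_stoch.1 ?kpow_ge0.
rewrite ler_pM ?exprn_ge0 ?invr_ge0 ?(ltW sparsity_gt0)//.
  exact: inv_sparsity_le.
exact: IH.
Qed.

(** Keep the single term of order [k = dist P x y] of the series; from [k! <= k^k <= (D t)^k]
    follows [t^k / k! >= D^-k]. *)
Lemma heat_ge_exp D t x y : 1 <= D -> 1 <= t -> (dist P x y)%:R <= D * t ->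
  expR (- ((1 + D * ln (D * Delta)) * t)) <= heat P t x y.
Proof.
move=> D1 t1 dD; have t0 : 0 < t by apply: lt_le_trans t1.
have D0 : 0 < D by apply: lt_le_trans D1.
have S0 := sparsity_gt0.
apply: le_trans (heat_ge_term P_stoch x y (dist P x y) (ltW t0)).
set k := dist P x y.
rewrite mulrDl mul1r opprD expRD ler_wpM2l ?expR_ge0//.
have DS1 : 1 <= D * Delta.
  have := sparsity_ge2 => h; rewrite -[leLHS]mulr1 ler_pM//.
  by apply: le_trans h; rewrite ler1n.
apply: (@le_trans _ _ ((D * Delta)^-1 ^+ k)).
  rewrite -[X in X ^+ k]lnK ?posrE ?invr_gt0 ?mulr_gt0// -expRM_natl ler_expR.
  rewrite lnV ?posrE ?mulr_gt0// mulrN lerN2 mulrAC ler_wpM2r// ln_ge0//.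
rewrite invfM exprMn mulrC -mulrA; apply: ler_pM.
- by rewrite exprn_ge0// invr_ge0 ltW.
- by rewrite exprn_ge0// invr_ge0 ltW.
- exact: kpow_dist_ge.
rewrite ler_pdivlMr ?ltr0n ?fact_gt0// exprVn ler_pdivrMl ?exprn_gt0//.
rewrite -exprMn; apply: (@le_trans _ _ (k%:R ^+ k)).
  rewrite -natrX ler_nat.
  have fact_le j : (j <= k)%N -> (j`! <= k ^ j)%N.
    by elim: j => // j IH jk; rewrite factS expnS leq_mul// IH// ltnW.
  exact: fact_le.
by rewrite lerXn2r ?nnegrE ?ler0n// mulr_ge0// ltW.
Qed.

(* Compare the terms of order [k+1] at [y] and [k] at [x]: their ratio involves
   [1/(k+1) >= (1 - e^(k+1-m))/m], and [e^k] turns the series at time [t] into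
   the one at time [e t].  The exponent [(e-1)t] comes from there. *)
Lemma heat_neighbour_ge t m o x y : 0 < t -> 1 <= m -> 0 < P x y -> x != y ->
  expR (1 - m + (expR 1 - 1) * t) <= 2^-1 * heat P t o x ->
  t / (2 * Delta * m) * heat P t o x <= heat P t o y.
Proof.
move=> t0 m1 xy nxy small.
have m0 : 0 < m by apply: lt_le_trans m1.
have S0 := sparsity_gt0.
set q := t / (Delta * m); have q0 : 0 < q by rewrite divr_gt0 ?mulr_gt0.
set e : R := expR 1; have e0 : 0 < e := expR_gt0 _.
have et0 : 0 <= e * t by rewrite mulr_ge0// ltW.
pose b := expR (1 - m).
have term k : q * (kcoeff P o x k * t ^+ k - b * (kcoeff P o x k * (e * t) ^+ k)) <=
    kcoeff P o y k.+1 * t ^+ k.+1.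
  have kx : kpow P k o x * Delta^-1 <= kpow P k.+1 o y.
    rewrite kpowSr (bigD1 x)//=; apply: ler_wpDr.
      by apply: sumr_ge0 => w _; rewrite mulr_ge0 ?P_stoch.1 ?kpow_ge0.
    by rewrite ler_wpM2l ?kpow_ge0// inv_sparsity_le.
  (* As [b e^k = e^(k+1-m)], the left side is at most [1/m] when [k+1 <= m] and nonpositive
     otherwise. *)
  have inv : m^-1 * (1 - b * e ^+ k) <= k.+1%:R^-1.
    rewrite /b /e -expRM_natl mulr1 -expRD mulrC ler_pdivrMr// ler_pdivlMl ?ltr0n//.
    have [km|mk] := leP k.+1%:R m.
      apply: le_trans km; rewrite ger_pMr ?ltr0n// gerBl; exact: expR_ge0.
    apply: le_trans (ltW m0); rewrite pmulr_rle0 ?ltr0n// subr_le0.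
    by rewrite -[leLHS]expR0 ler_expR; move: mk; rewrite -natr1; lra.
  rewrite [kcoeff P o y _]/kcoeff factS natrM invfM exprS.
  have -> : q * (kcoeff P o x k * t ^+ k - b * (kcoeff P o x k * (e * t) ^+ k)) =
     (kpow P k o x * Delta^-1) * (m^-1 * (1 - b * e ^+ k)) * (t * (t ^+ k / k`!%:R)).
    rewrite /kcoeff /q exprMn; field.
    by rewrite !gt_eqF ?ltr0n ?fact_gt0.
  have -> : kpow P k.+1 o y * (k.+1%:R^-1 * k`!%:R^-1) * (t * t ^+ k) =
     kpow P k.+1 o y * k.+1%:R^-1 * (t * (t ^+ k / k`!%:R)) by ring.
  have w0 : 0 <= t * (t ^+ k / k`!%:R).
    by rewrite mulr_ge0 ?(ltW t0)// divr_ge0 ?ler0n// exprn_ge0// ltW.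
  rewrite ler_wpM2r//.
  have kx0 : 0 <= kpow P k o x * Delta^-1.
    by rewrite mulr_ge0 ?kpow_ge0// invr_ge0 ltW.
  apply: (@le_trans _ _ (kpow P k o x * Delta^-1 * k.+1%:R^-1)).
    by rewrite ler_wpM2l.
  by rewrite ler_wpM2r// invr_ge0 ler0n.
have partial n : q * (pseries (kcoeff P o x) t n - b * pseries (kcoeff P o x) (e * t) n)
    <= kexp P o y t.
  have := pseries_le_kexp P_stoch o y n.+1 (ltW t0); apply: le_trans.
  rewrite /pseries /series/= big_nat_recl//= expr0 mulr1; apply: ler_wpDl.
    by rewrite divr_ge0 ?ler0n//; exact: (kpow_ge0 P_stoch 0).
  rewrite !mulr_sumr -sumrB mulr_sumr; apply: ler_sum => k _.
  exact: term.
have lim : q * (kexp P o x t - b * kexp P o x (e * t)) <= kexp P o y t.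
  apply: (@ler_cvg_to _ \oo _ _ (fun n => q * (pseries (kcoeff P o x) t n -
      b * pseries (kcoeff P o x) (e * t) n)) (cst (kexp P o y t))).
  - apply: cvgM; first exact: cvg_cst.
    apply: cvgB; first exact: is_cvg_kexp.
    by apply: cvgM; [exact: cvg_cst|exact: is_cvg_kexp].
  - exact: cvg_cst.
  - by near=> n; exact: partial.
move: small; rewrite !heatE => small.
have ke : kexp P o x (e * t) <= expR (e * t).
  have := heatE P (e * t) o x; set h := heat _ _ _ _ => hE.
  have h1 : h <= 1.
    rewrite -(heat_sum1 P_stoch o et0) (bigD1 x)//= lerDl sumr_ge0// => z _.
    exact: heat_ge0.
  move: h1; rewrite hE expRN mulrC ler_pdivrMr ?expR_gt0//; by rewrite mul1r.
(* The smallness hypothesis makes the correction at most half of the main term, whence the factor 2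
   in the conclusion. *)
have bke : b * kexp P o x (e * t) <= 2^-1 * kexp P o x t.
  apply: (@le_trans _ _ (b * expR (e * t))); first by rewrite ler_wpM2l ?expR_ge0.
  move: small; rewrite mulrCA expRN.
  rewrite [X in _ <= X]mulrC ler_pdivlMr ?expR_gt0// => h; apply: le_trans h.
  rewrite /b -!expRD ler_expR -/e; lra.
rewrite mulrCA ler_wpM2l ?expR_ge0//; apply: le_trans lim.
have -> : t / (2 * Delta * m) * kexp P o x t = q * (2^-1 * kexp P o x t).
  by rewrite /q; field; rewrite !gt_eqF.
by rewrite ler_wpM2l ?(ltW q0)//; lra.
Unshelve. all: by end_near. Qed.

End Sparsity.

(** * The cutoff window *)

Section Window.
Context {R : realType} {X : finType}.
Variables (P : X -> X -> R) (pi : X -> R).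
Hypothesis P_stoch : stochastic P.
Hypothesis P_irr : irreducible P.
Hypothesis pi_inv : invariant_law P pi.
Hypothesis P_sym : symmetric_support P.
Hypothesis P_curved : nonneg_curved P.
Hypothesis card_ge3 : (3 <= #|X|)%N.

Local Notation Delta := (sparsity P).
Local Notation T := (trel P pi).

Lemma pi_neighbour x y : 0 < P x y -> x != y -> pi x <= Delta * pi y.
Proof.
move=> xy nxy; have S0 := sparsity_gt0 P_stoch P_irr P_sym card_ge3.
rewrite -ler_pdivrMl// -[leRHS]pi_inv.2 (bigD1 x)//=; apply: ler_wpDr.
  by apply: sumr_ge0 => z _; rewrite mulr_ge0 ?pi_inv.1.1 ?P_stoch.1.
rewrite mulrC ler_wpM2l ?pi_inv.1.1//.
exact: inv_sparsity_le.
Qed.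

(** A density ratio of at most [2 (e + 2 + D^2) Delta^3] between neighbours has logarithm at most
    this multiple of [ln Delta], because [ln Delta >= ln 2]. *)
Definition lip_const (D : R) : R := 3 + ln (2 * (expR 1 + 2 + D ^+ 2)) / ln 2.

Lemma ln2_gt0 : 0 < ln 2 :> R.
Proof. by rewrite ln_gt0// ltr1n. Qed.

Lemma ln2_le1 : ln 2 <= 1 :> R.
Proof. by apply: (@le_ln1Dx R 1); lra. Qed.

Lemma ln_sparsity_ge : ln 2 <= ln Delta.
Proof.
have S2 := sparsity_ge2 P_stoch P_irr P_sym card_ge3.
by rewrite ler_ln ?posrE//; apply: lt_le_trans S2.
Qed.

(** The global lower bound [e^(-a t)] feeds the neighbour comparison at level [m = b t]. The ratio
    of heat kernels costs two factors [Delta], that of [pi] a third. *)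
Lemma log_density_lip D t o : 1 <= D -> 1 <= t ->
  (forall x y, (dist P x y)%:R <= D * t) ->
  lip P (lip_const D * ln Delta) (fun x => ln (heat P t o x / pi x)).
Proof.
move=> D1 t1 dD.
have S2 := sparsity_ge2 P_stoch P_irr P_sym card_ge3.
have S0 := sparsity_gt0 P_stoch P_irr P_sym card_ge3.
have pi0 := pi_gt0 P_stoch P_irr pi_inv.
have t0 : 0 < t by apply: lt_le_trans t1.
have D0 : 0 < D by apply: lt_le_trans D1.
have e0 : 0 < expR 1 :> R := expR_gt0 _.
have DS1 : 1 <= D * Delta by rewrite -[leLHS]mulr1 ler_pM//; lra.
have lDS : 0 <= D * ln (D * Delta) by rewrite mulr_ge0 ?(ltW D0)// ln_ge0.
pose a := 1 + D * ln (D * Delta).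
(* Chosen so that [1 - b t + (e - 1) t = 1 - 2 t - a t], which is at most [- ln 2 - a t] because
   [t >= 1]. *)
pose b := expR 1 + 1 + a.
have Hge x := heat_ge_exp P_stoch P_irr P_sym card_ge3 D1 t1 (dD o x).
have H0 x : 0 < heat P t o x by apply: lt_le_trans (Hge x); exact: expR_gt0.
have b0 : 0 < b by rewrite /b /a; lra.
have ratio x y : 0 < P x y -> x != y ->
    heat P t o x <= 2 * Delta * b * heat P t o y.
  move=> xy nxy.
  have bt1 : 1 <= b * t by rewrite -[leLHS]mulr1 ler_pM// /b /a; lra.
  have := heat_neighbour_ge P_stoch P_irr P_sym card_ge3 (o := o) t0 bt1 xy nxy.
  have -> : t / (2 * Delta * (b * t)) = (2 * Delta * b)^-1.
    by field; rewrite !gt_eqF.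
  rewrite ler_pdivrMl ?mulr_gt0//; apply.
  apply: (@le_trans _ _ (2^-1 * expR (- (a * t)))); last by rewrite ler_wpM2l.
  rewrite -[X in X^-1](lnK (_ : 2 \is Num.pos)) ?posrE// -expRN -expRD ler_expR.
  have -> : 1 - b * t + (expR 1 - 1) * t = 1 - 2 * t - a * t by rewrite /b; ring.
  have := ln2_le1; lra.
have step x y : 0 < P x y -> x != y ->
    ln (heat P t o x / pi x) - ln (heat P t o y / pi y) <= lip_const D * ln Delta.
  move=> xy nxy.
  have yx : 0 < P y x := (P_sym x y).1 xy.
  have nyx : y != x by rewrite eq_sym.
  have C0 : 0 < expR 1 + 2 + D ^+ 2 by have := sqr_ge0 D; lra.
  have f0 z : 0 < heat P t o z / pi z by rewrite divr_gt0.
  (* [b] is only logarithmic in [Delta], yet a linear bound suffices since its logarithm is taken in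
     the end. *)
  have bC : b <= (expR 1 + 2 + D ^+ 2) * Delta.
    have h : ln (D * Delta) <= D * Delta by apply/ltW/ln_sublinear; rewrite mulr_gt0.
    have h1 : D * ln (D * Delta) <= D * (D * Delta) by rewrite ler_wpM2l// ltW.
    have h2 : (expR 1 + 2) * 1 <= (expR 1 + 2) * Delta by rewrite ler_wpM2l; lra.
    rewrite /b /a; lra.
  have fxy : heat P t o x / pi x <=
      2 * (expR 1 + 2 + D ^+ 2) * Delta ^+ 3 * (heat P t o y / pi y).
    rewrite ler_pdivrMr//; apply: le_trans (ratio _ _ xy nxy) _.
    have piyx := pi_neighbour yx nyx.
    apply: (@le_trans _ _ (2 * Delta * ((expR 1 + 2 + D ^+ 2) * Delta) * heat P t o y)).
      by rewrite ler_pM2r// ler_pM2l// mulr_gt0.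
    have -> : 2 * (expR 1 + 2 + D ^+ 2) * Delta ^+ 3 * (heat P t o y / pi y) * pi x =
       2 * Delta * ((expR 1 + 2 + D ^+ 2) * Delta) * heat P t o y * (Delta * pi x / pi y).
      by field; rewrite gt_eqF.
    rewrite ler_pMr; first by rewrite ler_pdivlMr// mul1r.
    by rewrite mulr_gt0// !mulr_gt0.
  rewrite lerBlDr; apply: (@le_trans _ _ (ln (2 * (expR 1 + 2 + D ^+ 2) * Delta ^+ 3 *
      (heat P t o y / pi y)))).
    by rewrite ler_ln ?posrE// mulr_gt0// mulr_gt0 ?exprn_gt0// mulr_gt0.
  have C2 : 0 < 2 * (expR 1 + 2 + D ^+ 2) by rewrite mulr_gt0.
  have D3 : 0 < Delta ^+ 3 by rewrite exprn_gt0.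
  have CD : 0 < 2 * (expR 1 + 2 + D ^+ 2) * Delta ^+ 3 by rewrite mulr_gt0.
  rewrite (lnM CD (f0 y)) lerD2r (lnM C2 D3) lnXn// /lip_const.
  set c := ln (2 * _).
  have c0 : 0 <= c by rewrite ln_ge0//; have := sqr_ge0 D; lra.
  have : c * 1 <= c * (ln Delta / ln 2).
    by rewrite ler_wpM2l// ler_pdivlMr ?ln2_gt0// mul1r ln_sparsity_ge.
  rewrite -[ln Delta *+ 3]mulr_natl; lra.
move=> x y xy; rewrite ler_norml.
have [->|nxy] := eqVneq x y.
  suff : 0 <= lip_const D * ln Delta.
    by rewrite subrr => L0; apply/andP; split; lra.
  rewrite mulr_ge0//.
    rewrite /lip_const addr_ge0// divr_ge0 ?(ltW ln2_gt0)// ln_ge0//.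
    have := sqr_ge0 D; lra.
  by apply: le_trans ln_sparsity_ge; exact: ltW ln2_gt0.
have := step _ _ xy nxy; have := step y x ((P_sym x y).1 xy).
by rewrite eq_sym nxy => /(_ isT) h1 h2; apply/andP; split; lra.
Qed.

Lemma mixed_window eps t L : 0 < eps <= 1 -> mixed P pi (1 - eps) t ->
  0 < t -> 0 < L -> (forall o x, 0 < heat P t o x) ->
  (forall o, lip P L (fun x => ln (heat P t o x / pi x))) ->
  mixed P pi eps
    (t + T * (L * Num.sqrt (2 * t / eps) + 3 / 2 * ln (2 / eps))).
Proof.
move=> /andP[e0 e1] [_ tv] t0 L0 H0 gL.
have card_ge2 : (2 <= #|X|)%N by exact: ltnW.
have T0 : 0 < T by apply: trel_gt0.
have pi0 := pi_gt0 P_stoch P_irr pi_inv.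
set r := L * Num.sqrt _; set l := ln (2 / eps).
have te0 : 0 < 2 * t / eps by rewrite divr_gt0// mulr_gt0.
have r0 : 0 < r by rewrite mulr_gt0// sqrtr_gt0.
(* [r] is calibrated so that Chebyshev leaves out mass at most [eps/2]. *)
have r2 : L ^+ 2 * t = r ^+ 2 * (eps / 2).
  by rewrite /r exprMn sqr_sqrtr ?(ltW te0)//; field; rewrite gt_eqF.
have l0 : 0 <= l by rewrite ln_ge0// ler_pdivlMr// mul1r; lra.
have el : expR (- l) = eps / 2.
  by rewrite expRN lnK ?posrE ?divr_gt0// invf_div.
have s0 : 0 <= T * (r + 3 / 2 * l).
  by rewrite mulr_ge0 ?(ltW T0)// addr_ge0 ?(ltW r0)// mulr_ge0// divr_ge0.
split=> [|o]; first by rewrite addr_ge0// ltW.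
pose g x := ln (heat P t o x / pi x).
pose m := heatf P t g o.
pose A : {set X} := [set x | `|g x - m| <= r]%SET.
have gE x : heat P t o x = expR (g x) * pi x.
  by rewrite /g lnK ?posrE ?divr_gt0// divfK// gt_eqF.
have cheb : \sum_(x | x \notin A) heat P t o x <= eps / 2.
  have := local_poincare P_stoch P_irr o P_curved (ltW t0) (ltW L0) (gL o).
  rewrite -/g -/m r2 => lp.
  have r20 : 0 < r ^+ 2 by rewrite exprn_gt0.
  rewrite -(ler_pM2l r20); apply: le_trans lp.
  have -> : heatf P t (fun z => g z ^+ 2) o - m ^+ 2 =
      \sum_x heat P t o x * (g x - m) ^+ 2.
    transitivity (\sum_x (heat P t o x * g x ^+ 2 - 2 * m * (heat P t o x * g x) +
       m ^+ 2 * heat P t o x)); last by apply: eq_bigr => x _; ring.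
    rewrite big_split/= sumrB -[X in _ = _ - X + _]mulr_sumr -[X in _ = _ + X]mulr_sumr.
    rewrite heat_sum1 ?(ltW t0)//.
    by rewrite -/(heatf P t g o) -/m /heatf; ring.
  rewrite mulr_sumr big_mkcond/=; apply: ler_sum => x _; case: ifPn.
    rewrite inE -ltNge => gr; rewrite mulrC ler_wpM2l ?heat_ge0 ?(ltW t0)//.
    rewrite -(real_normK (num_real (g x - m))).
    by rewrite lerXn2r ?nnegrE ?normr_ge0 ?(ltW r0)// ltW.
  by move=> _; rewrite mulr_ge0 ?sqr_ge0 ?heat_ge0 ?(ltW t0).
have piA : eps / 2 <= \sum_(x in A) pi x.
  have := le_dTV (heat P t o) pi A; have := tv o.
  have := heat_sum1 P_stoch o (ltW t0); rewrite (bigID [in A])/= => h.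
  rewrite ler_norml; lra.
(* On [A] the density is at least [e^(m-r)], so that [eps/2 <= pi(A) <= e^(r-m)]. *)
have ml : m <= r + l.
  have : eps / 2 <= expR (r - m).
    apply: le_trans piA _.
    apply: (@le_trans _ _ (\sum_x expR (r - m) * heat P t o x)); last first.
      by rewrite -mulr_sumr heat_sum1 ?(ltW t0)// mulr1.
    rewrite big_mkcond/=; apply: ler_sum => x _; case: ifPn => [|_]; last first.
      by rewrite mulr_ge0 ?expR_ge0 ?heat_ge0 ?(ltW t0).
    rewrite inE ler_norml => /andP[gm _].
    rewrite gE mulrA -expRD ler_peMl ?(ltW (pi0 x))// -[leLHS]expR0 ler_expR; lra.
  by rewrite -el ler_expR; lra.
have HA x : x \in A -> heat P t o x <= expR (2 * r + l) * pi x.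
  rewrite inE ler_norml => /andP[_ gm].
  by rewrite gE ler_wpM2r ?(ltW (pi0 x))// ler_expR; lra.
have := dTV_heat_le P_stoch P_irr pi_inv card_ge2 (ltW t0) s0 HA cheb.
(* With [K = 2 r + l], a time [T K / 2] cancels the density bound and a further [T l] brings the
   error down to [eps/2], whence the [3/2]. *)
have -> : (2 * r + l) / 2 - T * (r + 3 / 2 * l) / T = - l.
  by field; rewrite gt_eqF.
by rewrite el; lra.
Qed.

(** The three terms absorb the unit of time lost in approaching the infimum, the fluctuation of the
    log-density, and the term in [ln (2 / eps)]; [2 + 5 / eps] bounds the ratio of diameter to
    time. *)
Definition window_const (eps : R) : R :=
  2 / ln 2 + lip_const (2 + 5 / eps) * Num.sqrt (4 / eps) +
  3 / 2 * ln (2 / eps) / ln 2.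

(** Since [w >= ln 2 / 2] and [w >= T ln 2], the hypothesis forces [tau >= 1] and [T <= tau / 2],
    which makes the diameter linear in time. *)
Lemma tmix_window eps : 0 < eps < 1 ->
  (T * ln Delta) ^+ 2 <= ln 2 ^+ 2 / 4 * tmix P pi (1 - eps) ->
  tmix P pi eps - tmix P pi (1 - eps) <=
    window_const eps * (Num.sqrt (tmix P pi (1 - eps)) * (T * ln Delta)).
Proof.
move=> /andP[e0 e1]; set tau := tmix P pi (1 - eps); set w := T * ln Delta => wt.
have card_ge2 : (2 <= #|X|)%N by exact: ltnW.
have Th : 2^-1 <= T by apply: trel_ge_half.
have T0 : 0 < T by apply: trel_gt0.
have l2 := ln2_gt0; have lD := ln_sparsity_ge.
have ln22 : 0 < ln 2 ^+ 2 / 4 :> R by rewrite divr_gt0// exprn_gt0.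
have Tw : T * ln 2 <= w by rewrite ler_wpM2l// ltW.
have hw : ln 2 / 2 <= w.
  by apply: le_trans Tw; rewrite mulrC ler_wpM2r// ltW.
have w0 : 0 < w by apply: lt_le_trans hw; rewrite divr_gt0.
have tau1 : 1 <= tau.
  rewrite -(ler_pM2l ln22) mulr1; apply: le_trans wt.
  have -> : ln 2 ^+ 2 / 4 = (ln 2 / 2) ^+ 2 :> R by field.
  by rewrite lerXn2r ?nnegrE ?(ltW w0)// divr_ge0// ltW.
have Ttau : T <= tau / 2.
  have h : T * ln 2 * (ln 2 / 2) <= w * w.
    by apply: ler_pM => //; rewrite ?mulr_ge0 ?divr_ge0// ltW.
  have : T * (ln 2 ^+ 2 / 4) * 2 <= tau * (ln 2 ^+ 2 / 4).
    by rewrite [leRHS]mulrC; apply: le_trans wt; move: h; rewrite !expr2; lra.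
  rewrite mulrAC ler_pM2r//; lra.
have ee : 0 < 1 - eps <= 1 by apply/andP; split; lra.
(* Within 1 of the infimum, so that [tau <= t <= 2 tau]; hence the [4 / eps] in the window. *)
have [t tm /andP[taut tt]] := mixed_near_tmix P_stoch P_irr pi_inv card_ge2 ee ltr01.
rewrite -/tau in taut tt.
have t1 : 1 <= t by apply: le_trans taut.
have t0 : 0 < t by apply: lt_le_trans t1.
have e01 : 0 < eps <= 1 by rewrite e0 ltW.
have ei0 : 0 < eps^-1 by rewrite invr_gt0.
(* Bounds twice [2 t / eps + 1 + T / eps] by [D t], using [T <= t / 2] and [1 <= t]. *)
pose D := 2 + 5 / eps.
have D1 : 1 <= D.
  have : 0 <= 5 / eps by rewrite divr_ge0// ltW.
  by rewrite /D; lra.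
have dD x y : (dist P x y)%:R <= D * t.
  apply: le_trans (dist_le_mixed P_stoch P_irr pi_inv card_ge2 P_sym x y e01 tm) _.
  have Te0 : 0 <= T / eps by rewrite divr_ge0// ltW.
  have sq : Num.sqrt (T / eps) <= 1 + T / eps.
    rewrite -[leRHS]ger0_norm; last by rewrite addr_ge0.
    by rewrite -sqrtr_sqr ler_sqrt ?sqr_ge0//; nra.
  have : T / eps <= t / 2 / eps by rewrite ler_wpM2r ?(ltW ei0)//; lra.
  rewrite /D; lra.
have H0 o x : 0 < heat P t o x.
  apply: lt_le_trans (heat_ge_exp P_stoch P_irr P_sym card_ge3 D1 t1 (dD o x)).
  exact: expR_gt0.
have c0 : 0 < lip_const D.
  rewrite /lip_const ltr_wpDr// divr_ge0 ?(ltW l2)// ln_ge0//.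
  have := sqr_ge0 D; have := expR_gt0 (1 : R); lra.
have L0 : 0 < lip_const D * ln Delta.
  by rewrite mulr_gt0//; exact: lt_le_trans lD.
have gL o := log_density_lip o D1 t1 dD.
have e0' := ltW e0.
have := tmix_le e0' (mixed_window e01 tm t0 L0 H0 gL).
set s := Num.sqrt (2 * t / eps); set l := ln (2 / eps) => tmt.
have l0 : 0 <= l by rewrite ln_ge0// ler_pdivlMr// mul1r; lra.
set q := Num.sqrt tau.
have q1 : 1 <= q by rewrite -sqrtr1 ler_sqrt; lra.
have sq : s <= Num.sqrt (4 / eps) * q.
  rewrite /s /q -sqrtrM; last by rewrite divr_ge0.
  rewrite ler_sqrt; last by rewrite mulr_ge0 ?divr_ge0; lra.
  by rewrite [leRHS]mulrAC ler_wpM2r ?(ltW ei0)//; lra.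
have h1 : T * (lip_const D * ln Delta * s) <=
    lip_const D * Num.sqrt (4 / eps) * (q * w).
  have -> : T * (lip_const D * ln Delta * s) = lip_const D * w * s by rewrite /w; ring.
  have -> : lip_const D * Num.sqrt (4 / eps) * (q * w) =
    lip_const D * w * (Num.sqrt (4 / eps) * q) by ring.
  by rewrite ler_wpM2l// mulr_ge0 ?(ltW c0)// ltW.
have wq : w <= q * w by rewrite ler_peMl// ltW.
have h2 : T * (3 / 2 * l) <= 3 / 2 * l / ln 2 * (q * w).
  rewrite [leRHS]mulrAC ler_pdivlMr//.
  have -> : T * (3 / 2 * l) * ln 2 = 3 / 2 * l * (T * ln 2) by ring.
  by rewrite ler_wpM2l ?mulr_ge0 ?divr_ge0//; apply: le_trans wq.
have h3 : 1 <= 2 / ln 2 * (q * w).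
  rewrite mulrAC ler_pdivlMr// mul1r; lra.
rewrite /window_const -/D -/l; lra.
Qed.

End Window.

(** * Cutoff along a sequence of chains *)

Section Asymptotics.
Context {R : realType} {X : nat -> finType}.
Variables (P : forall n, X n -> X n -> R) (pi : forall n, X n -> R).
Arguments P : clear implicits.
Arguments pi : clear implicits.
Hypothesis card_ge3 : forall n, (3 <= #|X n|)%N.
Hypothesis P_stoch : forall n, stochastic (P n).
Hypothesis P_irr : forall n, irreducible (P n).
Hypothesis pi_inv : forall n, invariant_law (P n) (pi n).
Hypothesis P_sym : forall n, symmetric_support (P n).
Hypothesis P_curved : forall n, nonneg_curved (P n).

Arguments P_irr : clear implicits.
Arguments P_sym : clear implicits.
Local Notation tm n eps := (tmix (P n) (pi n) eps).
Local Notation T n := (trel (P n) (pi n)).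
Local Notation w n := (trel (P n) (pi n) * ln (sparsity (P n))).

Hypothesis product_condition : forall eps : R, 0 < eps < 1 ->
  (w n) ^+ 2 / tm n eps @[n --> \oo] --> (0 : R).

Let card_ge2 n : (2 <= #|X n|)%N. Proof. exact: ltnW. Qed.

Lemma trel_ln2_le n : T n * ln 2 <= w n.
Proof.
rewrite ler_wpM2l ?ln_sparsity_ge// ltW//; exact: trel_gt0.
Qed.

Lemma window_ge n : ln 2 / 2 <= w n.
Proof.
apply: le_trans (trel_ln2_le n); rewrite mulrC ler_wpM2r ?(ltW ln2_gt0)//.
exact: trel_ge_half.
Qed.

Lemma window_gt0 n : 0 < w n.
Proof. by apply: lt_le_trans (window_ge n); rewrite divr_gt0 ?ln2_gt0. Qed.

(** Of two distinct states one has stationary mass at most [1/2], and starting there leaves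
    [1 - 1/2 - 1/4 > 0]. *)
Lemma tmix_quarter_gt0 n : 0 < tm n 4^-1.
Proof.
have /card_gt1P[x [y [_ _ xy]]] := card_ge2 n.
have pixy : pi n x + pi n y <= 1.
  rewrite -(pi_inv n).1.2 (bigD1 x)//= (bigD1 y)/=; last by rewrite eq_sym.
  by rewrite addrA lerDl sumr_ge0// => z _; exact: (pi_inv n).1.1.
have q : 0 < (4^-1 : R) <= 1 by apply/andP; split; lra.
have hx := tmix_ge (P_stoch n) (P_irr n) (pi_inv n) (card_ge2 n) x q.
have hy := tmix_ge (P_stoch n) (P_irr n) (pi_inv n) (card_ge2 n) y q.
lra.
Qed.

Lemma window_sqr_le_quarter eta : 0 < eta ->
  \forall n \near \oo, (w n) ^+ 2 <= eta * tm n 4^-1.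
Proof.
move=> eta0.
have q : 0 < (4^-1 : R) < 1 by apply/andP; split; lra.
have /cvgrPdist_le/(_ eta eta0) := product_condition q.
apply: filterS => n /=; rewrite sub0r normrN => h.
by rewrite -ler_pdivrMr ?tmix_quarter_gt0//; apply: le_trans h; exact: ler_norm.
Qed.

(* A lower bound on the stationary law would bound the mixing time by a multiple
   of the relaxation time, against the product condition. *)
Lemma pi_small delta : 0 < delta <= 1 ->
  \forall n \near \oo, exists x, pi n x < delta.
Proof.
move=> /andP[d0 d1].
pose K := - ln delta; pose c := K / 2 - ln 4^-1.
have K0 : 0 <= K by rewrite oppr_ge0 ln_le0.
have l2 : 0 < ln 2 :> R := ln2_gt0.
have c0 : 0 < c.
  rewrite /c ltr_wpDl ?divr_ge0// oppr_gt0 lnV ?posrE// oppr_lt0 ln_gt0//.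
  by rewrite ltr1n.
(* With this [eta], the mixing bound [T c] would yield [w <= ln 2 / 4], against [w >= ln 2 / 2]. *)
have eta0 : 0 < ln 2 ^+ 2 / (4 * c) by rewrite divr_gt0 ?exprn_gt0 ?mulr_gt0.
apply: filterS (window_sqr_le_quarter eta0) => n wn.
have [//|no] := pselect (exists x, pi n x < delta).
have pid x : expR (- K) <= pi n x.
  rewrite /K opprK lnK// leNgt; apply/negP => xd; apply: no; by exists x.
have q : 0 < (4^-1 : R) <= 1 by apply/andP; split; lra.
have m := mixed_of_pi_ge (P_stoch n) (P_irr n) (pi_inv n) (card_ge2 n) K0 pid q.
have q0 : (0 : R) <= 4^-1 by lra.
have tmT := tmix_le q0 m; rewrite -/c in tmT.
have w0 := window_gt0 n; have wl := window_ge n; have wT := trel_ln2_le n.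
have : w n ^+ 2 <= ln 2 / 4 * w n.
  apply: le_trans wn _; apply: (@le_trans _ _ (ln 2 ^+ 2 / (4 * c) * (T n * c))).
    by rewrite ler_wpM2l// ltW.
  have -> : ln 2 ^+ 2 / (4 * c) * (T n * c) = ln 2 / 4 * (T n * ln 2).
    by field; rewrite gt_eqF.
  by rewrite ler_wpM2l// divr_ge0// ltW.
rewrite expr2 ler_pM2r//; lra.
Qed.

(** For large [n] some state has mass less than [1 - eps], and the chain started there needs a
    positive time. *)
Lemma tmix_gt0_near eps : 0 < eps < 1 -> \forall n \near \oo, 0 < tm n eps.
Proof.
move=> /andP[e0 e1].
have d : 0 < 1 - eps <= 1 by apply/andP; split; lra.
apply: filterS (pi_small d) => n [x xd].
have e : 0 < eps <= 1 by rewrite e0 ltW.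
have := tmix_ge (P_stoch n) (P_irr n) (pi_inv n) (card_ge2 n) x e; lra.
Qed.

Lemma window_sqr_le eps eta : 0 < eps < 1 -> 0 < eta ->
  \forall n \near \oo, 0 < tm n eps /\ (w n) ^+ 2 <= eta * tm n eps.
Proof.
move=> e eta0.
have /cvgrPdist_le/(_ eta eta0) := product_condition e.
apply: filterS2 (tmix_gt0_near e) => n tn /=; rewrite sub0r normrN => h; split=> //.
by rewrite -ler_pdivrMr//; apply: le_trans h; exact: ler_norm.
Qed.

Lemma tmix_window_near eps : 0 < eps < 1 -> \forall n \near \oo,
  tm n eps - tm n (1 - eps) <=
    window_const eps * (Num.sqrt (tm n (1 - eps)) * w n).
Proof.
move=> e; have /andP[e0 e1] := e.
have e' : 0 < 1 - eps < 1 by apply/andP; split; lra.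
have eta0 : 0 < ln 2 ^+ 2 / 4 :> R by rewrite divr_gt0 ?exprn_gt0 ?ln2_gt0.
apply: filterS (window_sqr_le e' eta0) => n [_ wn].
exact: tmix_window.
Qed.

(** The product condition makes [w] small against [sqrt b], where [b] is the mixing time at
    [1 - eps], so the window [sqrt b * w] is small against [b]. *)
Lemma tmix_gap_near eps zeta : 0 < eps < 1 -> 0 < zeta -> \forall n \near \oo,
  0 < tm n (1 - eps) /\ tm n eps - tm n (1 - eps) <= zeta * tm n (1 - eps).
Proof.
move=> e z0; have /andP[e0 e1] := e.
have e' : 0 < 1 - eps < 1 by apply/andP; split; lra.
pose C := `|window_const eps| + 1.
have C0 : 0 < C by rewrite /C ltr_wpDl.
have eta0 : 0 < (zeta / C) ^+ 2 by rewrite exprn_gt0 ?divr_gt0.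
apply: filterS2 (tmix_window_near e) (window_sqr_le e' eta0) => n win [b0 wn].
split=> //; apply: le_trans win _.
set b := tm n (1 - eps) in b0 wn *; set q := Num.sqrt b.
have q0 : 0 <= q by exact: sqrtr_ge0.
have qb : b = q * q by rewrite -expr2 sqr_sqrtr// ltW.
have w0 := window_gt0 n.
have wq : w n <= zeta / C * q.
  have zq0 : 0 <= zeta / C * q by rewrite mulr_ge0// divr_ge0 ?ltW.
  by rewrite -(@ler_pXn2r _ 2) ?nnegrE ?(ltW w0)// [leRHS]exprMn (expr2 q) -qb.
have CC : window_const eps <= C by have := ler_norm (window_const eps); rewrite /C; lra.
apply: (@le_trans _ _ (C * (q * w n))).
  by rewrite ler_wpM2r// mulr_ge0// ltW.
apply: (@le_trans _ _ (C * (q * (zeta / C * q)))).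
  by rewrite ler_pM2l// ler_wpM2l.
have -> : C * (q * (zeta / C * q)) = zeta * (q * q) by field; rewrite gt_eqF.
by rewrite -qb.
Qed.

(** The gap estimate is used at both [eps] and [1 - eps], because the sign of the gap depends on the
    side of [1/2] on which [eps] lies. *)
Lemma cutoff eps : 0 < eps < 1 ->
  tm n (1 - eps) / tm n eps @[n --> \oo] --> (1 : R).
Proof.
move=> e; have /andP[e0 e1] := e.
have e' : 0 < 1 - eps < 1 by apply/andP; split; lra.
apply/cvgrPdist_le => z z0.
apply: filterS2 (tmix_gap_near e z0) (tmix_gap_near e' z0) => n.
have -> : 1 - (1 - eps) = eps by ring.
set a := tm n eps; set b := tm n (1 - eps) => -[b0 ab] [a0 ba].
have -> : 1 - b / a = (a - b) / a by field; rewrite gt_eqF.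
rewrite normrM normfV (gtr0_norm a0) ler_pdivrMr// ler_norml.
have za : 0 <= z * a by rewrite mulr_ge0 ?(ltW z0)// ltW.
have [le_ab|lt_ba] := leP a b; first by apply/andP; split; lra.
have zba : z * b <= z * a by rewrite ler_wpM2l// ltW.
by apply/andP; split; lra.
Qed.

(** The finitely many early indices are absorbed by adding the sum of their ratios to the
    constant. *)
Lemma lesssim_of_near (a b : nat -> R) C : (forall n, 0 < b n) ->
  (\forall n \near \oo, a n <= C * b n) -> lesssim a b.
Proof.
move=> b0 [N _ HN].
pose D := \sum_(i < N) `|a i| / b i.
have D0 i : 0 <= `|a i| / b i by rewrite divr_ge0// ltW.
have D1 : 0 <= D by apply: sumr_ge0 => i _; exact: D0.
exists (`|C| + D) => n; have [Nn|nN] := leqP N n.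
  apply: le_trans (HN n Nn) _; rewrite ler_wpM2r ?(ltW (b0 n))//.
  by have := ler_norm C; lra.
apply: le_trans (ler_norm _) _; rewrite -ler_pdivrMr//.
apply: (@le_trans _ _ D); last by rewrite lerDr.
rewrite /D (bigD1 (Ordinal nN))//= lerDl sumr_ge0//.
Qed.

Lemma cutoff_window eps : 0 < eps < 2^-1 ->
  lesssim (fun n => tm n eps - tm n (1 - eps))
    (fun n => Num.sqrt (tm n 4^-1) * w n).
Proof.
move=> /andP[e0 e1].
have e : 0 < eps < 1 by apply/andP; split; lra.
apply: (@lesssim_of_near _ _ `|window_const eps|) => [n|].
  by rewrite mulr_gt0 ?window_gt0// sqrtr_gt0 tmix_quarter_gt0.
apply: filterS (tmix_window_near e) => n win; apply: le_trans win _.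
have q : 0 < (4^-1 : R) <= 1 by apply/andP; split; lra.
(* From [eps < 1/2]; monotonicity then bounds the mixing time at [1 - eps] by the one at [1/4]. *)
have q' : 4^-1 <= 1 - eps by lra.
have w0 := ltW (window_gt0 n).
apply: (@le_trans _ _ (`|window_const eps| * (Num.sqrt (tm n (1 - eps)) * w n))).
  by rewrite ler_wpM2r ?ler_norm// mulr_ge0// sqrtr_ge0.
rewrite ler_wpM2l// ler_wpM2r// ler_sqrt ?(ltW (tmix_quarter_gt0 n))//.
exact: tmix_anti.
Qed.

End Asymptotics.

Theorem theorem1 (R : realType) (X : nat -> finType)
  (P : forall n : nat, X n -> X n -> R) (pi : forall n : nat, X n -> R)
  (card_ge3 : forall n, (3 <= #|X n|)%N)
  (P_stochastic : forall n, stochastic (P n))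
  (P_irreducible : forall n, irreducible (P n))
  (pi_invariant : forall n, invariant_law (P n) (pi n))
  (P_symmetric : forall n, symmetric_support (P n))
  (P_curved : forall n, nonneg_curved (P n))
  (product_condition : forall eps : R, 0 < eps < 1 ->
     (trel (P n) (pi n) * ln (sparsity (P n))) ^+ 2 / tmix (P n) (pi n) eps
       @[n --> \oo] --> (0 : R)) :
  (forall eps : R, 0 < eps < 1 ->
     tmix (P n) (pi n) (1 - eps) / tmix (P n) (pi n) eps
       @[n --> \oo] --> (1 : R)) /\
  (forall eps : R, 0 < eps < 2^-1 ->
     lesssim
       (fun n => tmix (P n) (pi n) eps - tmix (P n) (pi n) (1 - eps))
       (fun n => Num.sqrt (tmix (P n) (pi n) 4^-1) *
                 (trel (P n) (pi n) * ln (sparsity (P n))))).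
Proof.
split=> eps e; first exact: (cutoff card_ge3).
exact: (cutoff_window card_ge3).
Qed.
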